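(* For every constant $k$, Action Executability is solvable in polynomial time on instances whose initial task network $(T,\prec^+,\alpha)$ is primitive with $\prec^+=\emptyset$ (an antichain) and whose state transition graph has at most $k$ states.
   Context: An HTN domain is a tuple $D=(F,A,\mathcal{C},\delta,M)$ where $F$ is a finite set of propositions, $A$ a set of actions, $\mathcal{C}$ a set of compound task names disjoint from $A$, $\delta$ maps each action $a$ to $(\mathrm{pre}(a),\mathrm{del}(a),\mathrm{add}(a))$, subsets of $F$, and $M$ gives decomposition methods for compound tasks. Action $a$ is executable in state $s\subseteq F$ if $\mathrm{pre}(a)\subseteq s$; executing it yields $(s\setminus\mathrm{del}(a))\cup\mathrm{add}(a)$. A task network is $(T,\prec^+,\alpha)$ with $T$ finite, $\prec^+$ a strict partial order on $T$, $\alpha:T\to A\cup\mathcal{C}$; primitive if $\alpha(T)\subseteq A$. A linearization is a total order $\bar t$ of $T$ extending $\prec^+$, with action sequence $\alpha(\bar t)$. For a primitive initial network $tn=(T,\prec^+,\alpha)$, a solution to $(D,tn,s_0)$ is a primitive network $(T',\prec'^+,\alpha')$ with $T'\subseteq T$, $\alpha'=\alpha|_{T'}$, $T'$ downward closed under $\prec^+$, $\prec'^+$ containing the restriction of $\prec^+$ to $T'$, and having a linearization whose action sequence is executable from $s_0$. Action Executability: given $tn$ in $D$, an initial state $s_0\subseteq F$ and a multiset $S$ of actions in $A$, decide whether there is a solution to $(D,tn,s_0)$ with a linearization $\bar t$ whose action sequence $\alpha(\bar t)$ covers $S$ (each action occurs in $\alpha(\bar t)$ at least as often as in $S$). The state transition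 graph is the multigraph whose vertices are the states reachable from $s_0$ by any sequence of actions of $A$, with an arc labeled $a$ from $s$ to $s'$ whenever $a$ is executable in $s$ and yields $s'$. *)

(* Defs.v *)
From mathcomp Require Import all_boot.
Unset Printing Implicit Defensive.

(* Propositions are 0 .. hF-1.  Actions are 0 .. |acts|-1.  Compound task
   names are |acts| .. |acts|+hC-1 (so A and C are disjoint).  A task
   network is given by its labelling alpha : T -> A u C (T = 0..|labels|-1)
   and its strict partial order prec+ as the explicit list of all pairs. *)

Definition action_data := (seq nat * seq nat * seq nat)%type. (* pre, del, add *)
Definition tnet_data := (seq nat * seq (nat * nat))%type.     (* alpha, prec+ *)

Record instance := Instance {
  hF : nat;
  acts : seq action_data;
  hC : nat;
  methods : seq (nat * tnet_data);       (* M : (compound task index, subnetwork) *)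
  tn_labels : seq nat;
  tn_order : seq (nat * nat);
  init_state : seq nat;
  goal_ms : seq nat                      (* multiset S of actions *)
}.

Definition is_spo (ord : seq (nat * nat)) : bool :=
  all (fun p => p.1 != p.2) ord &&
  all (fun p => all (fun q => (p.2 != q.1) || ((p.1, q.2) \in ord)) ord) ord.

Definition wf_tnet (nA nC : nat) (tn : tnet_data) : bool :=
  all (fun l => l < nA + nC) tn.1 &&
  all (fun p => (p.1 < size tn.1) && (p.2 < size tn.1)) tn.2 &&
  is_spo tn.2.

Definition wf_instance (I : instance) : bool :=
  let nA := size (acts I) in
  all (fun a => all (fun f => f < hF I) a.1.1 && all (fun f => f < hF I) a.1.2
                && all (fun f => f < hF I) a.2) (acts I) &&
  all (fun m => (nA <= m.1 < nA + hC I) && wf_tnet nA (hC I) m.2) (methods I) &&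
  wf_tnet nA (hC I) (tn_labels I, tn_order I) &&
  all (fun f => f < hF I) (init_state I) &&
  all (fun a => a < nA) (goal_ms I).

Definition primitive_tn (I : instance) : bool :=
  all (fun l => l < size (acts I)) (tn_labels I).

Definition state (I : instance) := {set 'I_(hF I)}.

Definition aset (I : instance) (l : seq nat) : state I := [set i | val i \in l].

Definition act_of (I : instance) (a : nat) : action_data :=
  nth ([::], [::], [::]) (acts I) a.

Definition apply_act (I : instance) (s : state I) (a : nat) : option (state I) :=
  let d := act_of I a in
  if aset I d.1.1 \subset s then Some ((s :\: aset I d.1.2) :|: aset I d.2)
  else None.

Definition exec_from (I : instance) (s : state I) (l : seq nat) : option (state I) :=
  foldl (fun os a => obind (fun s' => apply_act I s' a) os) (Some s) l.

Definition s0 (I : instance) : state I := aset I (init_state I).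

(* vertices of the state transition graph: states reachable from s0 by any
   sequence of actions of A *)
Definition reachable (I : instance) (s : state I) : Prop :=
  exists l : seq nat, all (fun a => a < size (acts I)) l /\ exec_from I (s0 I) l = Some s.

Definition at_most_k_states (I : instance) (k : nat) : Prop :=
  forall ss : seq (state I), uniq ss -> (forall s, s \in ss -> reachable I s) -> size ss <= k.

Definition action_executable (I : instance) : Prop :=
  let m := size (tn_labels I) in
  exists (T' : {set 'I_m}) (prec' : rel 'I_m) (tbar : seq 'I_m),
    (forall t u : 'I_m, (val t, val u) \in tn_order I -> u \in T' -> t \in T') /\
    (forall t, t \in T' -> ~~ prec' t t) /\
    (forall t u v, t \in T' -> u \in T' -> v \in T' -> prec' t u -> prec' u v -> prec' t v) /\
    (forall t u, t \in T' -> u \in T' -> (val t, val u) \in tn_order I -> prec' t u) /\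
    uniq tbar /\ (forall t, (t \in tbar) = (t \in T')) /\
    (forall t u, t \in T' -> u \in T' -> prec' t u -> index t tbar < index u tbar) /\
    exec_from I (s0 I) [seq nth 0 (tn_labels I) (val t) | t <- tbar] != None /\
    (forall a, count_mem a (goal_ms I) <= count_mem a [seq nth 0 (tn_labels I) (val t) | t <- tbar]).

(* Natural numbers in unary (all numbers in a well-formed instance are
   indices bounded by explicitly listed objects, so this is polynomially
   equivalent to binary encodings). *)

Definition enc_nat (n : nat) : seq bool := nseq n true ++ [:: false].
Definition enc_list (T : Type) (f : T -> seq bool) (s : seq T) : seq bool :=
  enc_nat (size s) ++ flatten (map f s).
Definition enc_pair (T U : Type) (f : T -> seq bool) (g : U -> seq bool) (p : T * U) :=
  f p.1 ++ g p.2.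
Definition enc_seqnat := @enc_list nat enc_nat.
Definition enc_action (a : action_data) : seq bool :=
  enc_seqnat a.1.1 ++ enc_seqnat a.1.2 ++ enc_seqnat a.2.
Definition enc_order := @enc_list (nat*nat) (@enc_pair nat nat enc_nat enc_nat).
Definition enc_tnet (tn : tnet_data) : seq bool := enc_seqnat tn.1 ++ enc_order tn.2.

Definition encode (I : instance) : seq bool :=
  enc_nat (hF I) ++ @enc_list _ enc_action (acts I) ++ enc_nat (hC I) ++
  @enc_list _ (@enc_pair _ _ enc_nat enc_tnet) (methods I) ++
  enc_seqnat (tn_labels I) ++ enc_order (tn_order I) ++
  enc_seqnat (init_state I) ++ enc_seqnat (goal_ms I).

Inductive move := MoveL | MoveR | Stay.

Record TM := {
  tm_Q : nat;
  tm_start : 'I_tm_Q;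
  tm_delta : 'I_tm_Q -> option bool -> option ('I_tm_Q * option bool * move);
  tm_acc : 'I_tm_Q -> bool
}.

(* configuration: state, reversed left part, scanned symbol, right part *)
Record config (M : TM) := Config {
  c_state : 'I_(tm_Q M);
  c_left : seq (option bool);
  c_head : option bool;
  c_right : seq (option bool)
}.

Definition init_config (M : TM) (x : seq bool) : config M :=
  match x with
  | [::] => @Config M (tm_start M) [::] None [::]
  | b :: x' => @Config M (tm_start M) [::] (Some b) (map Some x')
  end.

Definition step (M : TM) (c : config M) : config M :=
  match tm_delta M (c_state M c) (c_head M c) with
  | None => c
  | Some (q', w, MoveL) =>
      match c_left M c with
      | [::] => @Config M q' [::] None (w :: c_right M c)
      | l :: ls => @Config M q' ls l (w :: c_right M c)
      end
  | Some (q', w, MoveR) =>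
      match c_right M c with
      | [::] => @Config M q' (w :: c_left M c) None [::]
      | r :: rs => @Config M q' (w :: c_left M c) r rs
      end
  | Some (q', w, Stay) => @Config M q' (c_left M c) w (c_right M c)
  end.

Definition halted (M : TM) (c : config M) : bool :=
  if tm_delta M (c_state M c) (c_head M c) is None then true else false.

Definition run (M : TM) (n : nat) (x : seq bool) : config M := iter n (step M) (init_config M x).

Definition decides_within (M : TM) (x : seq bool) (P : Prop) (t : nat) : Prop :=
  exists n, n <= t /\ halted M (run M n x) /\ (tm_acc M (c_state M (run M n x)) <-> P).

(* Main.v *)
From Stdlib Require Import ZArith.
Require Import Defs.
From mathcomp Require Import all_boot.
From mathcomp Require Import zify.

(* Fix a family of k states that contains the initial one and is closed under all enabled
   actions.  An action then matters only through its type, the partial function it induces on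
   this family, and there are at most (k+1)^k types.  A walk in the state graph is determined,
   up to the order of its arcs, by the numbers of times X(i, t) that type t is applied in state
   i; by Euler's theorem such numbers come from a walk iff they are balanced and their support
   is connected to the initial state.  Tasks of the same type being interchangeable, the walk
   can be realised by tasks that cover the multiset S iff each action of S is available often
   enough and, for every type t, the sum of X(i, t) over i lies between the number of elements
   of S and the number of tasks of type t.  The family (as k words of k actions reaching its
   states) and the constantly many numbers X(i, t) can be coded by integers of polynomial size,
   so that exhaustive search takes polynomial time.

   The search is written in a language of arithmetic expressions with bounded sums and
   truncated iteration, whose values are polynomially bounded in the input size.  Such
   expressions are evaluated with a fixed number of unary counters, which a Turing machine keeps
   on interleaved tracks to the left of its starting position. *)

(** Only [k] is constant, while actions, propositions and tasks are unbounded; whatever the search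
    enumerates must therefore be a tuple of constant length with small entries. Multiplicities of
    single actions form no such tuple, as there may be arbitrarily many actions; multiplicities of
    types do. A state is no small number either, being a set of propositions: it is represented by a
    word leading to it, and its membership bits are recomputed on demand.

    The family is guessed and then merely checked to be closed. It may repeat states, and its words
    are applied without testing preconditions: closure under enabled actions, together with the
    initial state at index 0, already makes every execution visible inside the family. The bound on
    reachable states guarantees that a family of the required size exists.

    One machine has to serve all instances, so the procedure is an expression whose shape depends on
    [k] alone. Unary arithmetic is polynomial as long as all values are; unrestricted iteration
    would allow repeated doubling, which is why iterations are truncated. *)

Set Implicit Arguments.
Unset Strict Implicit.

Local Arguments c_state {M} _.
Local Arguments c_head {M} _.
Local Arguments c_left {M} _.
Local Arguments c_right {M} _.
Local Arguments step {M} _.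
Local Arguments halted {M} _.

(** * Structured Turing machine programs *)

Inductive tprog :=
  | TSkip
  | TMove (m : move)
  | TWrite (w : option bool)
  | TSeq (p q : tprog)
  | TIf (c : option bool -> bool) (p q : tprog)
  | TWhile (c : option bool -> bool) (p : tprog).

Definition tape := ((Z -> option bool) * Z)%type.

Definition shift_pos (m : move) (z : Z) : Z :=
  match m with MoveL => (z - 1)%Z | MoveR => (z + 1)%Z | Stay => z end.

Definition upd (f : Z -> option bool) (z : Z) (w : option bool) : Z -> option bool :=
  fun y => if (y =? z)%Z then w else f y.

(** The step counts are exactly those of the flattened code: one for each test, one for the jump
    that skips the else branch or returns to the head of a loop. Hence [exec_sim] can speak of
    [iter n] with the same [n]. *)
Inductive exec : tprog -> tape -> tape -> nat -> Prop :=
  | ExSkip t : exec TSkip t t 0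
  | ExMove m f z : exec (TMove m) (f, z) (f, shift_pos m z) 1
  | ExWrite w f z : exec (TWrite w) (f, z) (upd f z w, z) 1
  | ExSeq p q t1 t2 t3 n1 n2 :
      exec p t1 t2 n1 -> exec q t2 t3 n2 -> exec (TSeq p q) t1 t3 (n1 + n2)
  | ExIfT (c : option bool -> bool) p q t t' n :
      c (t.1 t.2) -> exec p t t' n -> exec (TIf c p q) t t' (1 + n + 1)
  | ExIfF (c : option bool -> bool) p q t t' n :
      ~~ c (t.1 t.2) -> exec q t t' n -> exec (TIf c p q) t t' (1 + n)
  | ExWhileF (c : option bool -> bool) p t : ~~ c (t.1 t.2) -> exec (TWhile c p) t t 1
  | ExWhileT (c : option bool -> bool) p t1 t2 t3 n1 n2 :
      c (t1.1 t1.2) -> exec p t1 t2 n1 -> exec (TWhile c p) t2 t3 n2 ->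
      exec (TWhile c p) t1 t3 (1 + n1 + 1 + n2).

Definition instr := option bool -> (option bool * move * nat).

Fixpoint plen (p : tprog) : nat :=
  match p with
  | TSkip => 0
  | TMove _ | TWrite _ => 1
  | TSeq p q => plen p + plen q
  | TIf _ p q => (plen p + (plen q).+1).+1
  | TWhile _ p => (plen p + 1).+1
  end.

Fixpoint flatten_prog (p : tprog) (b : nat) : seq instr :=
  match p with
  | TSkip => [::]
  | TMove m => [:: fun s => (s, m, b.+1)]
  | TWrite w => [:: fun=> (w, Stay, b.+1)]
  | TSeq p q => flatten_prog p b ++ flatten_prog q (b + plen p)
  | TIf c p q =>
      (fun s => (s, Stay, if c s then b.+1 else b.+1 + plen p + 1)) ::
      flatten_prog p b.+1 ++
      (fun s => (s, Stay, b.+1 + plen p + 1 + plen q)) ::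
      flatten_prog q (b.+1 + plen p + 1)
  | TWhile c p =>
      (fun s => (s, Stay, if c s then b.+1 else b.+1 + plen p + 1)) ::
      flatten_prog p b.+1 ++ [:: fun s => (s, Stay, b)]
  end.

Lemma size_flatten_prog p b : size (flatten_prog p b) = plen p.
Proof.
elim: p b => //= [p IHp q IHq|c p IHp q IHq|c p IHp] b; rewrite !size_cat ?IHp //=.
- by rewrite IHq.
- by rewrite IHq.
Qed.

(* The two halting states are the two positions past the end of the code. *)
Definition tm_of_code (code : seq instr) : TM :=
  {| tm_Q := (size code).+2;
     tm_start := ord0;
     tm_delta := fun q s =>
       if onth code q is Some i then
         let: (w, m, q') := i s in Some (inord q', w, m)
       else None;
     tm_acc := fun q => q == (size code).+1 :> nat |}.

(** The default [None] of [nth] identifies lists that differ by trailing blanks, so that the two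
    finite halves of a configuration describe a total function on the integers. *)
Definition tape_match (M : TM) (c : config M) (t : tape) : Prop :=
  [/\ c_head c = t.1 t.2,
      forall i : nat, nth None (c_right c) i = t.1 (t.2 + 1 + Z.of_nat i)%Z &
      forall i : nat, nth None (c_left c) i = t.1 (t.2 - 1 - Z.of_nat i)%Z].

Section Simulation.

Variable code : seq instr.
Let M := tm_of_code code.

Definition embedded (b : nat) (q : seq instr) :=
  forall i, i < size q -> onth code (b + i) = onth q i.

Lemma embedded_cat b q1 q2 :
  embedded b (q1 ++ q2) -> embedded b q1 /\ embedded (b + size q1) q2.
Proof.
move=> h; split=> i hi.
  rewrite h ?size_cat; first by rewrite onth_cat hi.
  by apply: leq_trans (leq_addr _ _).
rewrite -addnA h; first by rewrite onth_cat ltnNge leq_addr addKn.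
by rewrite size_cat ltn_add2l.
Qed.

Lemma embedded_cons b i q :
  embedded b (i :: q) -> onth code b = Some i /\ embedded b.+1 q.
Proof.
move=> h; split; first by rewrite -(addn0 b) h.
by move=> j hj; rewrite addSnnS h.
Qed.

Lemma step_match b (i : instr) (c : config M) f z w m b' :
  onth code b = Some i -> c_state c = b :> nat -> tape_match c (f, z) ->
  i (f z) = (w, m, b') -> b' <= (size code).+1 ->
  c_state (step c) = b' :> nat /\
  tape_match (step c) (upd f z w, shift_pos m z).
Proof.
move=> hi hb [/= hh hr hl] hw hb'.
have -> : step c = match m with
  | MoveL => match c_left c with
             | [::] => @Config M (inord b') [::] None (w :: c_right c)
             | l :: ls => @Config M (inord b') ls l (w :: c_right c)
             end
  | MoveR => match c_right c with
             | [::] => @Config M (inord b') (w :: c_left c) None [::]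
             | r :: rs => @Config M (inord b') (w :: c_left c) r rs
             end
  | Stay => @Config M (inord b') (c_left c) w (c_right c)
  end.
  by rewrite /step /= hb hi hh hw; case: m {hw}.
have u1 y : y <> z -> upd f z w y = f y by rewrite /upd; case: Z.eqb_spec.
have u2 y : y = z -> upd f z w y = w by rewrite /upd; case: Z.eqb_spec.
case: m {hw} => /=.
- case e: (c_left c) => [|l ls]; (split; [by rewrite /= inordK | split=> /=]).
  + rewrite u1; last lia; move: (hl 0); rewrite e /= => ->; congr f; lia.
  + case=> [|j] /=; first by rewrite u2 //; lia.
    rewrite u1; last lia; rewrite hr; congr f; lia.
  + move=> j; rewrite u1; last lia; move: (hl j.+1); rewrite e /= => h.
    rewrite nth_nil h; congr f; lia.
  + rewrite u1; last lia; move: (hl 0); rewrite e /= => ->; congr f; lia.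
  + case=> [|j] /=; first by rewrite u2 //; lia.
    rewrite u1; last lia; rewrite hr; congr f; lia.
  + move=> j; rewrite u1; last lia; move: (hl j.+1); rewrite e /= => ->; congr f; lia.
- case e: (c_right c) => [|l ls]; (split; [by rewrite /= inordK | split=> /=]).
  + rewrite u1; last lia; move: (hr 0); rewrite e /= => ->; congr f; lia.
  + move=> j; rewrite u1; last lia; move: (hr j.+1); rewrite e /= => h.
    rewrite nth_nil h; congr f; lia.
  + case=> [|j] /=; first by rewrite u2 //; lia.
    rewrite u1; last lia; rewrite hl; congr f; lia.
  + rewrite u1; last lia; move: (hr 0); rewrite e /= => ->; congr f; lia.
  + move=> j; rewrite u1; last lia; move: (hr j.+1); rewrite e /= => ->; congr f; lia.
  + case=> [|j] /=; first by rewrite u2 //; lia.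
    rewrite u1; last lia; rewrite hl; congr f; lia.
- split; [by rewrite inordK | split=> /=].
  + by rewrite u2.
  + by move=> j; rewrite u1 ?hr //; lia.
  + by move=> j; rewrite u1 ?hl //; lia.
Qed.

Lemma upd_id f z y : upd f z (f z) y = f y.
Proof. by rewrite /upd; case: Z.eqb_spec => // ->. Qed.

Lemma tape_match_ext (c : config M) f g z :
  (forall y, f y = g y) -> tape_match c (f, z) -> tape_match c (g, z).
Proof. by move=> h [/= h1 h2 h3]; split=> /= *; rewrite -h. Qed.

Lemma jump_match b (i : instr) (c : config M) t b' :
  onth code b = Some i -> c_state c = b :> nat -> tape_match c t ->
  i (t.1 t.2) = (t.1 t.2, Stay, b') -> b' <= (size code).+1 ->
  c_state (step c) = b' :> nat /\ tape_match (step c) t.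
Proof.
case: t => f z /= hi hb hm hw hb'.
have [h1 h2] := step_match hi hb hm hw hb'; split=> //.
by apply: tape_match_ext h2 => y; exact: upd_id.
Qed.

Lemma exec_sim p t t' n :
  exec p t t' n -> forall b (c : config M),
  embedded b (flatten_prog p b) -> b + plen p <= size code ->
  c_state c = b :> nat -> tape_match c t ->
  c_state (iter n (@step M) c) = b + plen p :> nat /\
  tape_match (iter n (@step M) c) t'.
Proof.
elim=> {p t t' n}.
- by move=> t b c _ _ hb hm; rewrite /= addn0.
- move=> m f z b c /= /embedded_cons[hi _] hs hb hm; rewrite addn1 in hs *.
  have [|h1 h2] := step_match hi hb hm (erefl _); first by lia.
  split=> //; apply: tape_match_ext h2 => y; exact: upd_id.
- move=> w f z b c /= /embedded_cons[hi _] hs hb hm; rewrite addn1 in hs *.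
  by apply: step_match hi hb hm (erefl _) _; lia.
- move=> p q t1 t2 t3 n1 n2 _ IH1 _ IH2 b c /= /embedded_cat[].
  rewrite size_flatten_prog => e1 e2 hs hb hm.
  have [|s1 m1] := IH1 b c e1 _ hb hm; first by lia.
  have [|s2 m2] := IH2 _ _ e2 _ s1 m1; first by lia.
  by rewrite addnC iterD; split=> //; rewrite s2; lia.
- move=> cd p q t t' n hc _ IH b c /= /embedded_cons[hi].
  move=> /embedded_cat[e1 /embedded_cons[hj _]] hs hb hm.
  rewrite size_flatten_prog in hj.
  have [||s1 m1] := jump_match (b' := b.+1) hi hb hm; rewrite ?hc //; first by lia.
  have [|s2 m2] := IH _ _ e1 _ s1 m1; first by lia.
  have [||s3 m3] := jump_match (b' := b.+1 + plen p + 1 + plen q) hj s2 m2.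
  + by [].
  + by lia.
  rewrite (_ : 0 + n + 1 = n.+1); last by lia.
  by rewrite iterSr; split=> //; rewrite s3; lia.
- move=> cd p q t t' n hc _ IH b c /= /embedded_cons[hi].
  move=> /embedded_cat[_ /embedded_cons[_ e1]] hs hb hm.
  rewrite size_flatten_prog in e1.
  have [||s1 m1] := jump_match (b' := b.+1 + plen p + 1) hi hb hm; rewrite ?(negbTE hc) //.
    by lia.
  have [||s2 m2] := IH (b.+1 + plen p + 1) (step c) _ _ s1 m1.
  + by move: e1; rewrite addn1.
  + by lia.
  rewrite -iterS iterSr; split=> //; rewrite s2; lia.
- move=> cd p t hc b c /= /embedded_cons[hi _] hs hb hm.
  have [||s1 m1] := jump_match (b' := b.+1 + plen p + 1) hi hb hm; rewrite ?(negbTE hc) //.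
    by lia.
  by split=> //; rewrite s1; lia.
- move=> cd p t1 t2 t3 n1 n2 hc _ IH1 _ IH2 b c /= he hs hb hm.
  have /embedded_cons[hi /embedded_cat[e1 /embedded_cons[hj _]]] := he.
  rewrite size_flatten_prog in hj.
  have [||s1 m1] := jump_match (b' := b.+1) hi hb hm; rewrite ?hc //; first by lia.
  have [|s2 m2] := IH1 _ _ e1 _ s1 m1; first by lia.
  have [||s3 m3] := jump_match (b' := b) hj s2 m2; [by [] | by lia |].
  have [s4 m4] := IH2 _ _ he hs s3 m3.
  rewrite -iterS (_ : (0 + n1 + 1 + n2).+1 = n2 + (n1.+1).+1); last by lia.
  by rewrite iterD iterS iterSr.
Qed.

End Simulation.

(** The additional instruction turns the symbol under the head into the verdict: of the two halting
    addresses past the end, [(plen p).+2] is the accepting one. *)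
Definition tm_of_prog (p : tprog) : TM :=
  tm_of_code (flatten_prog p 0 ++
    [:: fun s => (s, Stay, if s == Some true then (plen p).+2 else (plen p).+1)]).

(** Coordinates put the input at cell 2: cell 0 becomes the origin of the tracks, and the blank cell
    1 gives room for the prefix that [load_input] shifts left by one. *)
Definition input_tape (x : seq bool) : Z -> option bool :=
  fun z => if (z <? 2)%Z then None else onth x (Z.to_nat (z - 2)).

Lemma init_match M x : tape_match (init_config M x) (input_tape x, 2%Z).
Proof.
have hl (i : nat) : nth None [::] i = input_tape x (2 - 1 - Z.of_nat i)%Z.
  by rewrite /input_tape nth_nil; case: Z.ltb_spec => //; lia.
have hr (i : nat) : input_tape x (2 + 1 + Z.of_nat i)%Z = onth x i.+1.
  rewrite /input_tape; case: Z.ltb_spec; first by lia.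
  by move=> _; congr onth; lia.
case: x hl hr => [|b x] hl hr; split=> //= i; rewrite hr ?nth_nil //.
by rewrite -onthE.
Qed.

Lemma tm_of_prog_decides p x f z n (P : Prop) T :
  exec p (input_tape x, 2%Z) (f, z) n -> n < T -> (f z = Some true <-> P) ->
  decides_within (tm_of_prog p) x P T.
Proof.
move=> hx hn hP; exists n.+1; split=> //.
rewrite /run iterS /tm_of_prog; set code := flatten_prog p 0 ++ _.
have sc : size code = (plen p).+1 by rewrite size_cat size_flatten_prog addn1.
have he : embedded code 0 code by [].
have [e1] := embedded_cat he; rewrite size_flatten_prog => /embedded_cons[hi _].
have hs0 : c_state (init_config (tm_of_code code) x) = 0 :> nat by case: (x).
have [|s1 m1] := exec_sim hx e1 _ hs0 (init_match (tm_of_code code) x).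
  by rewrite sc add0n.
have [||s2 m2] := jump_match (b' := if f z == Some true then (plen p).+2 else (plen p).+1)
   hi s1 m1.
- by [].
- by rewrite sc; case: ifP.
split; last first.
  rewrite /= s2 -hP sc; case: (f z =P Some true) => [e|h]; rewrite ?eqxx //.
  by split=> // /eqP; lia.
rewrite /halted /= s2.
by rewrite onth_default // sc; case: ifP.
Qed.

(** * Tracks and counters on the tape *)

Local Notation "p ;; q" := (TSeq p q) (at level 61, right associativity).

Fixpoint moves (m : move) (n : nat) : tprog :=
  if n is n'.+1 then TMove m ;; moves m n' else TSkip.

Definition sgn_move (m : move) : Z := shift_pos m 0.

Lemma sgnL : sgn_move MoveL = (-1)%Z. Proof. by []. Qed.
Lemma sgnR : sgn_move MoveR = 1%Z. Proof. by []. Qed.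

Lemma exec_moves m n f z z' : z' = (z + Z.of_nat n * sgn_move m)%Z ->
  exec (moves m n) (f, z) (f, z') n.
Proof.
move=> ->; elim: n z => [|n IH] z /=.
  by rewrite Z.add_0_r; constructor.
rewrite -(add1n n); apply: ExSeq; first by constructor.
have -> : (z + Z.of_nat (1 + n) * sgn_move m =
           shift_pos m z + Z.of_nat n * sgn_move m)%Z; last by exact: IH.
by rewrite /sgn_move; case: m {IH} => /=; lia.
Qed.

Definition scan (m : move) (d : nat) : tprog := TWhile isSome (moves m d).

Lemma exec_scan m d n (f : Z -> option bool) z z' :
  z' = (z + Z.of_nat n * (Z.of_nat d * sgn_move m))%Z ->
  (forall i : nat, i < n -> f (z + Z.of_nat i * (Z.of_nat d * sgn_move m))%Z) ->
  f z' = None ->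
  exec (scan m d) (f, z) (f, z') (n * (d + 2) + 1).
Proof.
move=> ->; elim: n z => [|n IH] z h e.
  by rewrite Z.add_0_r in e *; rewrite mul0n; apply: ExWhileF; rewrite /= e.
rewrite (_ : _ + 1 = 1 + d + 1 + (n * (d + 2) + 1)); last by lia.
apply: ExWhileT; first by rewrite /=; move: (h 0 isT); rewrite Z.add_0_r.
  by apply: exec_moves.
rewrite (_ : (z + Z.of_nat n.+1 * (Z.of_nat d * sgn_move m) =
  (z + Z.of_nat d * sgn_move m) + Z.of_nat n * (Z.of_nat d * sgn_move m))%Z) in e *; last by lia.
apply: IH => // i hi.
have := h i.+1 hi; congr (isSome (f _)); lia.
Qed.

Section Tracks.

Variable V : nat.

(* Track [j < V] occupies every [V]-th cell to the left of cell [0].  Its block [0] is blank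
   and serves as the sentinel on the way back; its contents start at block [1]. *)
Definition cell (j i : nat) : Z := (- Z.of_nat (1 + j + i * V))%Z.

Lemma cell_inj j i j' i' : j < V -> j' < V -> cell j i = cell j' i' -> j = j' /\ i = i'.
Proof.
move=> hj hj' h; have {}h : i * V + j = i' * V + j' by rewrite /cell in h; lia.
have V0 : 0 < V by lia.
split; first by have := congr1 (modn^~ V) h; rewrite /= !modnMDl !modn_small.
by have := congr1 (divn^~ V) h; rewrite /= !divnMDl // !divn_small // !addn0.
Qed.

Definition holds_tracks (S : nat -> seq bool) (f : Z -> option bool) :=
  forall j i, j < V -> f (cell j i) = if i is i'.+1 then onth (S j) i' else None.

(** Returning to cell 0 makes operations composable; keeping the cells from 0 on intact is what
    allows [push] while unread input still lies there. *)
Definition runs (p : tprog) (S S' : nat -> seq bool) (T : nat) :=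
  forall f, holds_tracks S f -> exists f' n,
    [/\ exec p (f, 0%Z) (f', 0%Z) n, n <= T, holds_tracks S' f' &
        forall z, (0 <= z)%Z -> f' z = f z].

Definition set_track (S : nat -> seq bool) j v : nat -> seq bool :=
  fun i => if i == j then v else S i.

(** A common bound for all operations on a track of length [n]: at most two scans with [V + 2] steps
    per block, and moves over a bounded number of blocks. The factor 10 is slack. *)
Definition op_cost (n : nat) := 10 * (V + 2) * n.+1.

Lemma op_cost_le m n : m <= n -> op_cost m <= op_cost n.
Proof. by move=> h; rewrite leq_mul2l ltnS h orbT. Qed.

Lemma exec_scanL S f j : holds_tracks S f -> j < V ->
  exec (scan MoveL V) (f, cell j 1) (f, cell j (size (S j)).+1) (size (S j) * (V + 2) + 1).
Proof.
move=> hf hj; apply: exec_scan.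
- by rewrite /cell ?sgnL ?sgnR; lia.
- move=> i hi; rewrite (_ : (_ + _)%Z = cell j i.+1); last by rewrite /cell ?sgnL ?sgnR; lia.
  by rewrite hf // onthTE.
- by rewrite hf // onth_default.
Qed.

Lemma exec_scanR S f j n : holds_tracks S f -> j < V -> n <= size (S j) ->
  exec (scan MoveR V) (f, cell j n) (f, cell j 0) (n * (V + 2) + 1).
Proof.
move=> hf hj hn; apply: exec_scan.
- by rewrite /cell ?sgnL ?sgnR; lia.
- move=> i hi.
  rewrite (_ : (_ + _)%Z = cell j (n - i.+1).+1); last by rewrite /cell ?sgnL ?sgnR; nia.
  by rewrite hf // onthTE; lia.
- by rewrite hf.
Qed.

Definition back_to_origin (j : nat) : tprog := moves MoveR V ;; scan MoveR V ;; moves MoveR j.+1.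

Lemma exec_back S f j n : holds_tracks S f -> j < V -> n <= size (S j) ->
  exec (back_to_origin j) (f, cell j n.+1) (f, 0%Z) (V + (n * (V + 2) + 1 + j.+1)).
Proof.
move=> hf hj hn; apply: ExSeq; first by apply: (@exec_moves _ _ _ _ (cell j n)); rewrite /cell ?sgnL ?sgnR; lia.
apply: ExSeq; first by apply: exec_scanR hn.
by apply: exec_moves; rewrite /cell ?sgnL ?sgnR; lia.
Qed.

Definition goto_top (j : nat) : tprog := moves MoveL (j.+1 + V).
Definition leave_top (j : nat) : tprog := moves MoveR (j.+1 + V).

Lemma exec_goto_top f j : exec (goto_top j) (f, 0%Z) (f, cell j 1) (j.+1 + V).
Proof. by apply: exec_moves; rewrite /cell ?sgnL ?sgnR; lia. Qed.

Lemma exec_leave_top f j : exec (leave_top j) (f, cell j 1) (f, 0%Z) (j.+1 + V).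
Proof. by apply: exec_moves; rewrite /cell ?sgnL ?sgnR; lia. Qed.

Definition push (b : bool) (j : nat) : tprog :=
  goto_top j ;; scan MoveL V ;; TWrite (Some b) ;; back_to_origin j.

Lemma upd_track S f j i w s' : holds_tracks S f -> j < V ->
  (forall i', onth s' i' = if i' == i then w else onth (S j) i') ->
  holds_tracks (set_track S j s') (upd f (cell j i.+1) w).
Proof.
move=> hf hj hs j' i' hj'; rewrite /upd /set_track.
case: Z.eqb_spec => [e|ne].
  by have [-> ->] := cell_inj hj' hj e; rewrite eqxx hs eqxx.
rewrite hf //; case: eqP => // e; rewrite e in ne *.
case: i' ne => // i' ne; rewrite hs; case: eqP => // e'.
by rewrite e' in ne.
Qed.

Lemma upd_nonneg f j i w z : (0 <= z)%Z -> upd f (cell j i) w z = f z.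
Proof. by move=> hz; rewrite /upd; case: Z.eqb_spec => // e; rewrite /cell in e; lia. Qed.

Lemma runs_push b S j : j < V ->
  runs (push b j) S (set_track S j (rcons (S j) b)) (op_cost (size (S j))).
Proof.
move=> hj f hf; set n := size (S j).
have hf' : holds_tracks (set_track S j (rcons (S j) b)) (upd f (cell j n.+1) (Some b)).
  apply: upd_track => // i.
  by rewrite -cats1 onth_cat; case: ltngtP => // h; rewrite ?h ?subnn // !onth_default //= /n; lia.
exists (upd f (cell j n.+1) (Some b)); eexists; split.
- apply: ExSeq; first by apply: exec_goto_top.
  apply: ExSeq; first by apply: exec_scanL hf _.
  apply: ExSeq; first by constructor.
  apply: exec_back hf' _ _ => //.
  by rewrite /set_track eqxx size_rcons /n.
- by rewrite /op_cost -/n; lia.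
- by [].
- by move=> z hz; rewrite upd_nonneg.
Qed.

(** On an empty track the step back from the end of the scan lands on the blank block 0, which the
    test detects; the head then only has to return. *)
Definition pop (j : nat) : tprog :=
  goto_top j ;; scan MoveL V ;; moves MoveR V ;;
  TIf isSome (TWrite None ;; back_to_origin j) (moves MoveR j.+1).

Lemma runs_pop S j : j < V ->
  runs (pop j) S (set_track S j (take (size (S j)).-1 (S j))) (op_cost (size (S j))).
Proof.
move=> hj f hf; set n := size (S j).
have E1 (i : nat) : exec (moves MoveR V) (f, cell j i.+1) (f, cell j i) V.
  by apply: exec_moves; rewrite /cell ?sgnL ?sgnR; lia.
case en: n => [|m].
  exists f; eexists; split.
  - apply: ExSeq; first by apply: exec_goto_top.
    apply: ExSeq; first by apply: exec_scanL hf _.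
    rewrite -/n en; apply: ExSeq; first by exact: E1.
    apply: ExIfF; first by rewrite /= hf.
    by apply: exec_moves; rewrite /cell ?sgnL ?sgnR; lia.
  - by rewrite /op_cost -/n en; lia.
  - move=> j' i hj'; rewrite hf //; case: i => // i; rewrite /set_track.
    by case: eqP => // ->; rewrite take0 !onth_default // -/n en.
  - by [].
have hf' : holds_tracks (set_track S j (take m (S j))) (upd f (cell j m.+1) None).
  apply: upd_track => // i; rewrite -[in RHS](cat_take_drop m (S j)) onth_cat.
  have sz : size (take m (S j)) = m by rewrite size_take -/n en ltnSn.
  rewrite sz; case: ltngtP => // h; rewrite !onth_default ?sz //; try lia.
  by rewrite size_drop -/n en; lia.
exists (upd f (cell j m.+1) None); eexists; split.
- apply: ExSeq; first by apply: exec_goto_top.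
  apply: ExSeq; first by apply: exec_scanL hf _.
  rewrite -/n en; apply: ExSeq; first by exact: E1.
  apply: ExIfT; first by rewrite /= hf // onthTE -/n en.
  apply: ExSeq; first by constructor.
  apply: exec_back hf' _ _ => //.
  by rewrite /set_track eqxx size_take -/n en ltnSn.
- by rewrite /op_cost -/n en; lia.
- by rewrite /=.
- by move=> z hz; rewrite upd_nonneg.
Qed.

Lemma runs_seq p q S1 S2 S3 T1 T2 :
  runs p S1 S2 T1 -> runs q S2 S3 T2 -> runs (p ;; q) S1 S3 (T1 + T2).
Proof.
move=> h1 h2 f /h1[f1 [n1 [e1 l1 r1 k1]]].
have [f2 [n2 [e2 l2 r2 k2]]] := h2 _ r1.
exists f2, (n1 + n2); split=> //; first by apply: ExSeq e1 e2.
  by apply: leq_add.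
by move=> z hz; rewrite k2 ?k1.
Qed.

Lemma runs_le p S1 S2 T T' : runs p S1 S2 T -> T <= T' -> runs p S1 S2 T'.
Proof.
move=> h hT f /h[f1 [n1 [e1 l1 r1 k1]]].
by exists f1, n1; split=> //; apply: leq_trans hT.
Qed.

Lemma runs_eq p S1 S2 S1' S2' T :
  S1 =1 S1' -> S2 =1 S2' -> runs p S1 S2 T -> runs p S1' S2' T.
Proof.
move=> h1 h2 h f hf; have [|f1 [n1 [e1 l1 r1 k1]]] := h f.
  by move=> j i hj; rewrite h1 hf.
by exists f1, n1; split=> // j i hj; rewrite -h2 r1.
Qed.

Lemma runs_skip S : runs TSkip S S 0.
Proof. by move=> f hf; exists f, 0; split=> //; constructor. Qed.

Definition while_nonempty (j : nat) (p : tprog) : tprog :=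
  goto_top j ;; TWhile isSome (leave_top j ;; p ;; goto_top j) ;; leave_top j.

Lemma runs_while j p (St : nat -> nat -> seq bool) n T : j < V ->
  (forall i, i < n -> St i j <> [::] /\ runs p (St i) (St i.+1) T) ->
  St n j = [::] ->
  runs (while_nonempty j p) (St 0) (St n) (n * (T + op_cost 0) + op_cost 0).
Proof.
move=> hj hi hn f hf.
have test m g : holds_tracks (St m) g -> isSome (g (cell j 1)) = (St m j != [::]).
  by move=> hg; rewrite hg // onthTE; case: (St m j).
suff [f' [t [e1 l1 r1 k1]]] : exists f' t,
    [/\ exec (TWhile isSome (leave_top j ;; p ;; goto_top j)) (f, cell j 1) (f', cell j 1) t,
        t <= n * (T + op_cost 0) + 1, holds_tracks (St n) f' &
        forall z, (0 <= z)%Z -> f' z = f z].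
  exists f'; eexists; split; last by [].
  - apply: ExSeq; first by apply: exec_goto_top.
    apply: ExSeq; first by exact: e1.
    by apply: exec_leave_top.
  - by move: l1; rewrite /op_cost; lia.
  - by [].
elim: n St f hf hi hn test => [|n IH] St f hf hi hn test.
  exists f, 1; split=> //; apply: ExWhileF; by rewrite /= (test _ _ hf) hn.
have [h0 h1] := hi 0 isT; have [f1 [t1 [e1 l1 r1 k1]]] := h1 _ hf.
have [|f2 [t2 [e2 l2 r2 k2]]] := IH (fun i => St i.+1) f1 r1 _ hn (fun m => test m.+1).
  by move=> i; exact: (hi i.+1).
exists f2; eexists; split; last by move=> z hz; rewrite k2 ?k1.
- apply: ExWhileT e2; first by rewrite /= (test _ _ hf); apply/eqP.
  apply: ExSeq; first by apply: exec_leave_top.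
  apply: ExSeq; first by exact: e1.
  by apply: exec_goto_top.
- by move: l1 l2; rewrite /op_cost; lia.
- by [].
Qed.

Definition if_nonempty (j : nat) (p q : tprog) : tprog :=
  goto_top j ;; TIf isSome (leave_top j ;; p) (leave_top j ;; q).

Lemma runs_if j p q S S' T : j < V ->
  runs (if S j == [::] then q else p) S S' T ->
  runs (if_nonempty j p q) S S' (T + op_cost 0).
Proof.
move=> hj h f hf; have [f1 [t1 [e1 l1 r1 k1]]] := h f hf.
have test : isSome (f (cell j 1)) = (S j != [::]).
  by rewrite hf // onthTE; case: (S j).
exists f1; case: eqP test e1 => hS test e1; eexists; split; try eassumption.
- apply: ExSeq; first by apply: exec_goto_top.
  apply: ExIfF; first by rewrite /= test.
  by apply: ExSeq e1; apply: exec_leave_top.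
- by move: l1; rewrite /op_cost; lia.
- apply: ExSeq; first by apply: exec_goto_top.
  apply: ExIfT; first by rewrite /= test.
  by apply: ExSeq e1; apply: exec_leave_top.
- by move: l1; rewrite /op_cost; lia.
Qed.

Definition bit_code (o : option bool) : nat :=
  match o with None => 0 | Some false => 1 | Some true => 2 end.

Definition read_at (v u : nat) : tprog :=
  let back := moves MoveL v ;; back_to_origin v in
  goto_top v ;; scan MoveL V ;; moves MoveR v ;;
  TIf isSome (TIf (pred1 (Some true)) (back ;; push true u ;; push true u)
                                      (back ;; push true u))
             back.

(* The end of track [v] is aligned with the symbol of track [0] at index [size (S v)]. *)
Lemma runs_read S v u : 0 < v < V -> 0 < u < V ->
  runs (read_at v u) S
       (set_track S u (S u ++ nseq (bit_code (onth (S 0) (size (S v)))) true))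
       (2 * op_cost (size (S u)).+1 + op_cost (size (S v))).
Proof.
move=> /andP[v0 vV] /andP[u0 uV] f hf; set n := size (S v); set m := size (S u).
have E1 : exec (moves MoveR v) (f, cell v n.+1) (f, cell 0 n.+1) v.
  by apply: exec_moves; rewrite /cell ?sgnL ?sgnR; lia.
have E2 : exec (moves MoveL v ;; back_to_origin v) (f, cell 0 n.+1) (f, 0%Z)
   (v + (V + (n * (V + 2) + 1 + v.+1))).
  apply: ExSeq; last by apply: exec_back hf _ _.
  by apply: exec_moves; rewrite /cell ?sgnL ?sgnR; lia.
have hc : f (cell 0 n.+1) = onth (S 0) n by rewrite hf //; lia.
case e: (onth (S 0) n) => [[]|] /=; rewrite e in hc.
- have [f1 [t1 [e1 l1 r1 k1]]] := @runs_push true S u uV f hf.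
  have [f2 [t2 [e2 l2 r2 k2]]] := @runs_push true _ u uV f1 r1.
  exists f2; eexists; split; last by move=> z hz; rewrite k2 ?k1.
  + apply: ExSeq; first by apply: exec_goto_top.
    apply: ExSeq; first by apply: exec_scanL hf _.
    apply: ExSeq; first by exact: E1.
    apply: ExIfT; first by rewrite /= hc.
    apply: ExIfT; first by rewrite /= hc.
    apply: ExSeq; first by exact: E2.
    by apply: ExSeq e1 e2.
  + move: l2 l1; rewrite /set_track eqxx size_rcons -/m -/n /op_cost; lia.
  + move=> j i hj; rewrite r2 //; case: i => // i; rewrite /set_track.
    by case: eqP => // _; rewrite eqxx -!cats1 -catA.
- have [f1 [t1 [e1 l1 r1 k1]]] := @runs_push true S u uV f hf.
  exists f1; eexists; split; last by move=> z hz; rewrite ?k1.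
  + apply: ExSeq; first by apply: exec_goto_top.
    apply: ExSeq; first by apply: exec_scanL hf _.
    apply: ExSeq; first by exact: E1.
    apply: ExIfT; first by rewrite /= hc.
    apply: ExIfF; first by rewrite /= hc.
    by apply: ExSeq e1; exact: E2.
  + by move: l1; rewrite -/m -/n /op_cost; lia.
  + by rewrite cats1.
- exists f; eexists; split; last by [].
  + apply: ExSeq; first by apply: exec_goto_top.
    apply: ExSeq; first by apply: exec_scanL hf _.
    apply: ExSeq; first by exact: E1.
    apply: ExIfF; first by rewrite /= hc.
    by exact: E2.
  + by rewrite -/m -/n /op_cost; lia.
  + move=> j i hj; rewrite hf //; case: i => // i; rewrite /set_track.
    by case: eqP => // ->; rewrite cats0.
Qed.

(* While the input is being copied to track [0], a blank separates the copied prefix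
   (shifted one cell to the left) from the rest; scanning for this blank recovers the
   current position from cell [0]. *)
Definition goto_next : tprog := moves MoveR 1 ;; scan MoveR 1 ;; moves MoveR 1.

Definition copy_bit (b : bool) : tprog :=
  TWrite None ;; moves MoveL 1 ;; TWrite (Some b) ;; moves MoveL 1 ;;
  scan MoveL 1 ;; push b 0 ;; goto_next.

Definition load_input : tprog :=
  TWhile isSome (TIf (pred1 (Some true)) (copy_bit true) (copy_bit false)) ;;
  moves MoveL 2 ;; scan MoveL 1.

Definition load_inv (x : seq bool) (p : nat) (f : Z -> option bool) :=
  [/\ f 0%Z = None, f (1 + Z.of_nat p)%Z = None,
      forall i : nat, i < p -> f (1 + Z.of_nat i)%Z = onth x i,
      forall i : nat, p <= i -> f (2 + Z.of_nat i)%Z = onth x i &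
      holds_tracks (fun j => if j == 0 then take p x else [::]) f].

Hypothesis V_gt0 : 0 < V.

Lemma exec_copy_bit x p b f : p < size x -> onth x p = Some b -> load_inv x p f ->
  exists f' n, [/\ exec (copy_bit b) (f, (2 + Z.of_nat p)%Z) (f', (2 + Z.of_nat p.+1)%Z) n,
    n <= 2 * op_cost (size x) & load_inv x p.+1 f'].
Proof.
move=> hp hb [f0 fp fl fr ft].
set z := (2 + Z.of_nat p)%Z.
pose g := upd (upd f z None) (z - 1) (Some b).
have gout y : y <> z -> y <> (z - 1)%Z -> g y = f y.
  by move=> h1 h2; rewrite /g /upd; case: Z.eqb_spec => // _; case: Z.eqb_spec.
have gz : g z = None.
  by rewrite /g /upd; case: Z.eqb_spec => [|_]; [lia | case: Z.eqb_spec].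
have gz1 : g (z - 1)%Z = Some b by rewrite /g /upd; case: Z.eqb_spec.
have gt : holds_tracks (fun j => if j == 0 then take p x else [::]) g.
  by move=> j i hj; rewrite -(ft j i hj) gout // /cell; lia.
have gl i : i < p.+1 -> g (1 + Z.of_nat i)%Z = onth x i.
  rewrite ltnS leq_eqVlt => /orP[/eqP->|h].
    by rewrite hb -gz1; congr g; lia.
  by rewrite gout ?fl //; lia.
have [f' [n [e1 l1 r1 k1]]] := @runs_push b _ 0 V_gt0 g gt.
have f'0 : f' 0%Z = None by rewrite k1 // gout //; lia.
have f'l i : i < p.+1 -> f' (1 + Z.of_nat i)%Z = onth x i by move=> hi; rewrite k1 ?gl //; lia.
have f'z : f' z = None by rewrite k1 //; lia.
exists f'; eexists; split.
- apply: ExSeq; first by constructor.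
  apply: ExSeq; first by apply: (@exec_moves _ _ _ _ (z - 1)%Z); rewrite ?sgnL ?sgnR; lia.
  apply: ExSeq; first by constructor.
  apply: ExSeq; first by apply: (@exec_moves _ _ _ _ (z - 2)%Z); rewrite ?sgnL ?sgnR; lia.
  rewrite -/g; apply: ExSeq.
    apply: (@exec_scan _ _ p _ _ 0%Z).
    + by rewrite ?sgnL ?sgnR; lia.
    + move=> i hi; rewrite (_ : (_ + _)%Z = (1 + Z.of_nat (p.-1 - i))%Z).
        by rewrite gl ?onthTE //; lia.
      by rewrite ?sgnL ?sgnR; lia.
    + by rewrite gout //; lia.
  apply: ExSeq; first by exact: e1.
  apply: ExSeq; first by apply: (@exec_moves _ _ _ _ 1%Z).
  apply: ExSeq; last by apply: (@exec_moves _ 1 _ z); rewrite ?sgnL ?sgnR; lia.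
  apply: (@exec_scan _ _ p.+1) => //.
  + by rewrite ?sgnL ?sgnR; lia.
  + move=> i hi; rewrite (_ : (_ + _)%Z = (1 + Z.of_nat i)%Z).
      by rewrite f'l ?onthTE //; lia.
    by rewrite ?sgnL ?sgnR; lia.
- move: l1; rewrite eqxx size_take hp /op_cost; nia.
- split=> //.
  + by rewrite -f'z; congr f'; lia.
  + by move=> i hi; rewrite k1 ?gout ?fr //; lia.
  + move=> j i hj; rewrite r1 //; case: i => // i; rewrite /set_track.
    case: eqP => // _; have <- : nth b x p = b by apply: onth_nth.
    by rewrite (take_nth b).
Qed.

Lemma exec_load_input x : exists f n,
  [/\ exec load_input (input_tape x, 2%Z) (f, 0%Z) n,
      n <= (size x).+1 * (2 * op_cost (size x) + 8) &
      holds_tracks (fun j => if j == 0 then x else [::]) f].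
Proof.
have i0 : load_inv x 0 (input_tape x).
  rewrite /input_tape; split=> //.
  - by move=> i _; case: Z.ltb_spec => h; [lia | congr onth; lia].
  - move=> j i hj; rewrite take0 if_same /cell.
    by case: Z.ltb_spec => [_|]; [case: i => // i; rewrite onth0n | lia].
suff H p f : p <= size x -> load_inv x p f -> exists f' n,
    [/\ exec load_input (f, (2 + Z.of_nat p)%Z) (f', 0%Z) n,
        n <= (size x - p) * (2 * op_cost (size x) + 4) + 3 * size x + 8 & load_inv x (size x) f'].
  have [//|f [n [e1 l1 [_ _ _ _ r1]]]] := H 0 _ _ i0.
  exists f, n; split=> //; last by move=> j i hj; rewrite r1 // take_size.
  by move: l1; nia.
have [d] := ubnP (size x - p); elim: d => // d IH in p f * => hd hp hf.
have [f0 fp fl fr ft] := hf.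
rewrite leq_eqVlt in hp; case/orP: hp => [/eqP ep|hp].
  exists f; eexists; split; last by rewrite -ep.
  - apply: ExSeq; first by apply: ExWhileF; rewrite /= fr // onthTE; lia.
    apply: ExSeq; first by apply: (@exec_moves _ _ _ _ (Z.of_nat p)); rewrite ?sgnL ?sgnR; lia.
    apply: (@exec_scan _ _ p) => //.
    + by rewrite ?sgnL ?sgnR; lia.
    + move=> i hi; rewrite (_ : (_ + _)%Z = (1 + Z.of_nat (p.-1 - i))%Z).
        by rewrite fl ?onthTE //; lia.
      by rewrite ?sgnL ?sgnR; lia.
  - by nia.
have [b hb] : exists b, onth x p = Some b.
  by have := onthTE x p; rewrite hp; case: (onth x p) => // b _; exists b.
have [f1 [n1 [e1 l1 r1]]] := exec_copy_bit hp hb hf.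
have [||f2 [n2 [e2 l2 r2]]] := IH p.+1 f1 _ _ r1; [by lia | by lia |].
(* The induction hypothesis runs the loop followed by the return to cell 0; it is split so that one
   more round can be put in front of its loop. *)
inversion e2 as [| | |? ? ? t2 ? m1 m2 h1 h2| | | |]; subst.
have [m3 [e3 l3]] : exists m3,
    exec (TIf (pred1 (Some true)) (copy_bit true) (copy_bit false))
         (f, (2 + Z.of_nat p)%Z) (f1, (2 + Z.of_nat p.+1)%Z) m3 /\ m3 <= n1 + 2.
  case: b hb e1 => hb e1; eexists; split.
  - by apply: ExIfT e1; rewrite /= fr // hb.
  - by lia.
  - by apply: ExIfF e1; rewrite /= fr // hb.
  - by lia.
exists f2; eexists; split; last by [].
- apply: ExSeq h2; apply: ExWhileT h1; first by rewrite /= fr // hb.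
  exact: e3.
- by move: l1 l2 l3; nia.
Qed.

End Tracks.

(** * Polynomially bounded functions *)

Inductive poly : (nat -> nat) -> Prop :=
  | poly_id : poly (fun n => n)
  | poly_const c : poly (fun=> c)
  | poly_add p q : poly p -> poly q -> poly (fun n => p n + q n)
  | poly_mul p q : poly p -> poly q -> poly (fun n => p n * q n)
  | poly_ext p q : p =1 q -> poly p -> poly q.

Lemma poly_mono p m n : poly p -> m <= n -> p m <= p n.
Proof.
move=> hp h; elim: hp => //= [q r _ h1 _ h2|q r _ h1 _ h2|q r e _ h1].
- exact: leq_add.
- exact: leq_mul.
- by rewrite -!e.
Qed.

Lemma poly_comp p q : poly p -> poly q -> poly (fun n => p (q n)).
Proof.
move=> hp hq; elim: hp => //= [c|r t _ h1 _ h2|r t _ h1 _ h2|r t e _ h1].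
- exact: poly_const.
- exact: (poly_add h1 h2).
- exact: (poly_mul h1 h2).
- by apply: poly_ext h1 => n; rewrite e.
Qed.

Lemma poly_succ p : poly p -> poly (fun n => (p n).+1).
Proof. by move=> h; apply: poly_ext (poly_add (poly_const 1) h). Qed.

(** The summand 1 covers [n = 0] with [a = 0], where the left side is 1 and the power on the right
    may vanish. *)
Lemma leq_exp_addn n a b : n ^ a <= n ^ (a + b) + 1.
Proof.
case: n => [|n]; first by case: a => [|a]; rewrite ?expn0 ?leq_addl // exp0n.
by apply: leq_trans (leq_addr _ _); rewrite leq_pexp2l // leq_addr.
Qed.

Lemma poly_bound p : poly p -> exists c d, forall n, p n <= c * n ^ d + c.
Proof.
elim=> [|c|q r _ [c1 [d1 h1]] _ [c2 [d2 h2]]|q r _ [c1 [d1 h1]] _ [c2 [d2 h2]]|q r e _ [c [d h]]].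
- by exists 1, 1 => n; rewrite expn1; lia.
- by exists c, 0 => n; rewrite leq_addl.
- exists (c1 + c2).*2, (d1 + d2) => n.
  have := h1 n; have := h2 n.
  by have := leq_exp_addn n d1 d2; have := leq_exp_addn n d2 d1; rewrite (addnC d2); nia.
(* The product expands to four terms; each of the two mixed ones has a power at most
   [n ^ (d1 + d2) + 1], whence the factor 3. *)
- exists (3 * c1 * c2), (d1 + d2) => n.
  apply: leq_trans (leq_mul (h1 n) (h2 n)) _.
  have := leq_exp_addn n d1 d2; have := leq_exp_addn n d2 d1; rewrite (addnC d2) => a1 a2.
  rewrite (_ : _ * _ = c1 * c2 * (n ^ d1 * n ^ d2 + n ^ d1 + n ^ d2 + 1)); last by lia.
  rewrite -expnD (_ : _ + 3 * c1 * c2 = c1 * c2 * (3 * n ^ (d1 + d2) + 3)); last by lia.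
  by rewrite leq_mul2l; apply/orP; right; lia.
- by exists c, d => n; rewrite -e.
Qed.

Ltac poly_tac := repeat match goal with
  | |- poly (fun n => n) => exact: poly_id
  | |- poly (fun n => ?c) => exact: poly_const
  | |- poly (fun n => @?p n + @?q n) => apply: (@poly_add p q)
  | |- poly (fun n => @?p n * @?q n) => apply: (@poly_mul p q)
  | |- poly (fun n => S (@?p n)) => apply: (@poly_succ p)
  | H : poly ?f |- poly ?f => exact: H
  | H : poly ?f |- poly (fun n => ?f (@?q n)) => apply: (@poly_comp f q H)
  end.

(** * Programs with unary counters *)

Definition setc (s : nat -> nat) j v : nat -> nat := fun i => if i == j then v else s i.

Ltac get_tac := rewrite /setc; repeat (case: eqP => ?; subst); try lia.

Ltac st_tac := let c := fresh "c" in move=> c; rewrite /=; get_tac.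

Section Counters.

Variable C : nat.
Let V := C.+1.
Local Notation cost := (op_cost V).

Definition counter_tracks (x : seq bool) (s : nat -> nat) : nat -> seq bool :=
  fun j => if j is j'.+1 then nseq (s j') true else x.

Definition cruns x p s s' T := runs V p (counter_tracks x s) (counter_tracks x s') T.

Lemma set_counter_track x s j v :
  set_track (counter_tracks x s) j.+1 (nseq v true) =1 counter_tracks x (setc s j v).
Proof. by case=> [|i] //; rewrite /set_track /setc /= eqSS; case: eqP. Qed.

Lemma cruns_conv x p s1 s2 s2' T T' :
  cruns x p s1 s2 T -> s2 =1 s2' -> T <= T' -> cruns x p s1 s2' T'.
Proof.
move=> h e hT; apply: (runs_le _ hT); apply: runs_eq h => //.
by case=> [|j] //=; rewrite e.
Qed.

Lemma cruns_seq x p q s1 s2 s3 T1 T2 :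
  cruns x p s1 s2 T1 -> cruns x q s2 s3 T2 -> cruns x (p ;; q) s1 s3 (T1 + T2).
Proof. exact: runs_seq. Qed.

Definition inc j := push V true j.+1.
Definition dec j := pop V j.+1.
Definition while_pos j p := while_nonempty V j.+1 p.
Definition if_pos j p q := if_nonempty V j.+1 p q.
Definition read_counter v u := read_at V v.+1 u.+1.

Lemma cruns_inc x s j : j < C -> cruns x (inc j) s (setc s j (s j).+1) (cost (s j)).
Proof.
move=> hj; have := @runs_push V true (counter_tracks x s) j.+1 hj.
rewrite /= size_nseq; apply: runs_eq => // i.
rewrite -set_counter_track; congr set_track.
by rewrite -cats1 -[[:: true]]/(nseq 1 true) -nseqD addn1.
Qed.

Lemma cruns_dec x s j : j < C -> cruns x (dec j) s (setc s j (s j).-1) (cost (s j)).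
Proof.
move=> hj; have := @runs_pop V (counter_tracks x s) j.+1 hj.
rewrite /= size_nseq; apply: runs_eq => // i.
rewrite -set_counter_track; congr set_track.
by rewrite take_nseq // leq_pred.
Qed.

Lemma cruns_while x j p (St : nat -> nat -> nat) n T s s' : j < C ->
  (forall i, i < n -> 0 < St i j /\ cruns x p (St i) (St i.+1) T) ->
  St n j = 0 -> s =1 St 0 -> St n =1 s' ->
  cruns x (while_pos j p) s s' (n * (T + cost 0) + cost 0).
Proof.
move=> hj hi hn h0 h1.
have h : cruns x (while_pos j p) (St 0) (St n) (n * (T + cost 0) + cost 0).
  apply: (@runs_while V j.+1 p (fun i => counter_tracks x (St i))) => //= [i h|].
    have [hp hr] := hi i h; split=> //; by case: (St i j) hp.
  by rewrite hn.
by apply: runs_eq h; case=> [|i] //=; rewrite ?h0 ?h1.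
Qed.

Lemma cruns_if x j p q s s' T : j < C ->
  cruns x (if s j == 0 then q else p) s s' T ->
  cruns x (if_pos j p q) s s' (T + cost 0).
Proof.
move=> hj h; apply: runs_if => //=.
by move: h; case: (s j).
Qed.

Lemma cruns_skip x s : cruns x TSkip s s 0.
Proof. exact: runs_skip. Qed.

Lemma cruns_read x s v u : v < C -> u < C ->
  cruns x (read_counter v u) s (setc s u (s u + bit_code (onth x (s v))))
    (2 * cost (s u).+1 + cost (s v)).
Proof.
move=> hv hu; have := @runs_read V (counter_tracks x s) v.+1 u.+1 hv hu.
rewrite /= !size_nseq; apply: runs_eq => // i.
by rewrite -set_counter_track; congr set_track; rewrite -nseqD.
Qed.

(** Absorbs a loop of at most [B] rounds with up to three counter operations each; the constants are
    slack. *)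
Definition lcost (B : nat) := 5 * B.+1 * (5 * cost B.+1).

Lemma cost_le m n : m <= n -> cost m <= cost n.
Proof. exact: op_cost_le. Qed.

Definition clear a := while_pos a (dec a).

Lemma cruns_clear x s a B : a < C -> s a <= B -> cruns x (clear a) s (setc s a 0) (lcost B).
Proof.
move=> ha hB; apply: cruns_conv.
- apply: (@cruns_while x a (dec a) (fun i => setc s a (s a - i)) (s a) (cost (s a))) => //.
  + move=> i hi; split; first by rewrite /setc eqxx; lia.
    apply: cruns_conv (cruns_dec ha) _ _; first by st_tac.
    by apply: cost_le; rewrite /setc eqxx leq_subr.
  + by rewrite /setc eqxx subnn.
  + by st_tac.
- by st_tac.
- have := cost_le hB; have := cost_le (leqnSn B); have := cost_le (leq0n B).
  rewrite /lcost; nia.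
Qed.

Definition move_add a b := while_pos a (dec a ;; inc b).

Lemma cruns_move x s a b B : a < C -> b < C -> a <> b -> s a + s b <= B ->
  cruns x (move_add a b) s (setc (setc s b (s b + s a)) a 0) (lcost B).
Proof.
move=> ha hb ab hB; apply: cruns_conv.
- apply: (@cruns_while x a _ (fun i => setc (setc s b (s b + i)) a (s a - i)) (s a) (2 * cost B)) => //.
  + move=> i hi; split; first by rewrite /setc eqxx; lia.
    apply: cruns_conv; first by apply: cruns_seq (cruns_dec ha) (cruns_inc hb).
      by st_tac.
    rewrite mul2n -addnn; apply: leq_add; apply: cost_le; rewrite /setc;
    by repeat case: eqP => ?; try lia.
  + by rewrite /setc eqxx subnn.
  + by st_tac.
- by st_tac.
- have := cost_le (leqnSn B); have := cost_le (leq0n B).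
  have : s a <= B by lia.
  rewrite /lcost; nia.
Qed.

(** Transferring a unary counter empties it, so a second copy is kept in [t], from which [a] is
    restored. *)
Definition copy_add a b t := while_pos a (dec a ;; inc b ;; inc t) ;; move_add t a.

Lemma cruns_copy x s a b t B : a < C -> b < C -> t < C ->
  a <> b -> a <> t -> b <> t -> s t = 0 -> s a + s b <= B ->
  cruns x (copy_add a b t) s (setc s b (s b + s a)) (2 * lcost B).
Proof.
move=> ha hb ht ab at_ bt st0 hB; rewrite mul2n -addnn; apply: cruns_conv.
- apply: cruns_seq.
    apply: (@cruns_while x a _ (fun i => setc (setc (setc s b (s b + i)) a (s a - i)) t i) (s a) (3 * cost B)) => //.
    + move=> i hi; split; first by rewrite /setc eqxx; case: eqP => //; lia.
      apply: cruns_conv; first by apply: cruns_seq (cruns_dec ha) (cruns_seq (cruns_inc hb) (cruns_inc ht)).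
        by st_tac.
      rewrite (_ : 3 * _ = cost B + (cost B + cost B)); last by lia.
      apply: leq_add; last apply: leq_add; apply: cost_le; rewrite /setc;
      by repeat case: eqP => ?; try lia.
    + by rewrite /setc eqxx subnn; case: eqP.
    + by st_tac.
  apply: (@cruns_move x _ t a B) => //; first by move=> e; case: at_.
  by rewrite /setc; repeat case: eqP => ?; try lia.
- by st_tac.
- have := cost_le (leqnSn B); have := cost_le (leq0n B).
  have : s a <= B by lia.
  rewrite leq_add2r /lcost; nia.
Qed.

Fixpoint incs c j := if c is c'.+1 then inc j ;; incs c' j else TSkip.

Lemma cruns_incs x s c j : j < C ->
  cruns x (incs c j) s (setc s j (s j + c)) (c * cost (s j + c)).
Proof.
move=> hj; elim: c s => [|c IH] s /=.
  by apply: cruns_conv (@cruns_skip _ _) _ _ => //; st_tac.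
apply: cruns_conv; first by apply: cruns_seq (cruns_inc hj) (IH _).
  by st_tac.
rewrite mulSn; apply: leq_add; first by apply: cost_le; lia.
by rewrite /setc eqxx addSnnS.
Qed.

End Counters.

Lemma poly_op_cost V : poly (op_cost V).
Proof. rewrite /op_cost; poly_tac. Qed.

Lemma poly_lcost C : poly (lcost C).
Proof. rewrite /lcost; have h := poly_op_cost C.+1; poly_tac. Qed.

(** * Polynomially bounded arithmetic expressions over the input bits *)

(* De Bruijn expressions: [ESum] binds an index, [EIter] an index and an accumulator, [EDrop]
   weakens.  The values of an iteration are truncated by the value of its last argument, so
   that every expression is polynomially bounded. *)
Inductive expr :=
  | EVar (i : nat)
  | EConst (c : nat)
  | EBit (a : expr)
  | ELen
  | EAdd (a b : expr)
  | ESub (a b : expr)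
  | ESum (n b : expr)
  | EIter (n init body bound : expr)
  | EDrop (a : expr).

Fixpoint eval (x : seq bool) (e : expr) (env : seq nat) : nat :=
  match e with
  | EVar i => nth 0 env i
  | EConst c => c
  | EBit a => bit_code (onth x (eval x a env))
  | ELen => size x
  | EAdd a b => eval x a env + eval x b env
  | ESub a b => eval x a env - eval x b env
  | ESum n b => \sum_(i < eval x n env) eval x b ((i : nat) :: env)
  | EIter n init body bound =>
      iteri (eval x n env)
        (fun i acc => minn (eval x body [:: i, acc & env]) (eval x bound env))
        (eval x init env)
  | EDrop a => eval x a (behead env)
  end.

(** The critical case is [EIter]: after at least one round the value is at most that of the bound,
    whatever the body does, and without any round it is the initial value. Hence [p n + q n],
    independently of the number of rounds. *)
Lemma eval_poly e : exists2 p, poly p & forall x env, eval x e env <= p (size x + sumn env).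
Proof.
elim: e => [i|c|a _||a [p hp ap] b [q hq bq]|a [p hp ap] b _|n [p hp ap] b [q hq bq]
  |n _ a [p hp ap] b _ c [q hq cq]|a [p hp ap]].
- exists (fun n => n) => [|x env] /=; first by poly_tac.
  apply: leq_trans (leq_addl _ _); elim: env i => [|u env IH] [|i] //=; first by rewrite leq_addr.
  by apply: leq_trans (IH i) _; rewrite leq_addl.
- by exists (fun=> c) => //; poly_tac.
- by exists (fun=> 2) => [|x env] /=; [poly_tac | case: onth => [[]|]].
- by exists (fun n => n) => [|x env] /=; [poly_tac | rewrite leq_addr].
- by exists (fun n => p n + q n) => [|x env] /=; [poly_tac | apply: leq_add].
- by exists p => // x env /=; apply: leq_trans (leq_subr _ _) _.
- exists (fun n => p n * q (n + p n)) => [|x env] /=; first by poly_tac.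
  apply: leq_trans (_ : \sum_(i < eval x n env) q (size x + sumn env + p (size x + sumn env)) <= _).
    apply: leq_sum => i _; apply: leq_trans (bq _ _) _; apply: poly_mono => //=.
    by have := ltn_ord i; have := ap x env; lia.
  by rewrite sum_nat_const card_ord leq_mul2r ap orbT.
- exists (fun n => p n + q n) => [|x env] /=; first by poly_tac.
  case: (eval x n env) => [|m] /=; first by apply: leq_trans (ap _ _) (leq_addr _ _).
  by apply: leq_trans (geq_minr _ _) _; apply: leq_trans (cq _ _) (leq_addl _ _).
- exists p => // x env /=; apply: leq_trans (ap _ _) _; apply: poly_mono => //.
  by case: env => //= u env; lia.
Qed.

(** * Compilation of expressions to counter programs *)

Section Compilation.

Variable C : nat.
Local Notation cost := (op_cost C.+1).

(** [vars] lists the counters of the variables, and the counters from [fr] on are scratch, zero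
    before and after. The value is added to [out] instead of replacing it, so that [EAdd] is a
    sequence and [ESum] a plain loop over the body. *)
Fixpoint compile (e : expr) (vars : seq nat) (out fr : nat) : tprog :=
  match e with
  | EVar i => if i < size vars then copy_add C (nth 0 vars i) out fr else TSkip
  | EConst c => incs C c out
  | EBit a => compile a vars fr fr.+1 ;; read_counter C fr out ;; clear C fr
  | ELen =>
      read_counter C fr fr.+1 ;;
      while_pos C fr.+1 (clear C fr.+1 ;; inc C out ;; inc C fr ;; read_counter C fr fr.+1) ;;
      clear C fr
  | EAdd a b => compile a vars out fr ;; compile b vars out fr
  | ESub a b =>
      compile a vars fr fr.+2 ;; compile b vars fr.+1 fr.+2 ;;
      while_pos C fr.+1 (dec C fr.+1 ;; dec C fr) ;; move_add C fr out
  | ESum n b =>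
      compile n vars fr fr.+2 ;;
      while_pos C fr (dec C fr ;; compile b (fr.+1 :: vars) out fr.+2 ;; inc C fr.+1) ;;
      clear C fr.+1
  | EIter n init body bound =>
      let: (i, acc, o, o', fr') := (fr.+1, fr.+2, fr.+3, fr.+4, fr.+4.+1) in
      compile n vars fr fr' ;; compile init vars acc fr' ;;
      while_pos C fr
        (dec C fr ;; compile body [:: i, acc & vars] o fr' ;; clear C acc ;;
         compile bound vars o' fr' ;;
         while_pos C o (dec C o ;; if_pos C o' (dec C o' ;; inc C acc) TSkip) ;;
         clear C o' ;; inc C i) ;;
      clear C i ;; move_add C acc out
  | EDrop a => compile a (behead vars) out fr
  end.

Fixpoint scratch_space (e : expr) : nat :=
  match e with
  | EVar _ => 1
  | EConst _ => 0
  | EBit a => (scratch_space a).+1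
  | ELen => 2
  | EAdd a b => maxn (scratch_space a) (scratch_space b)
  | ESub a b | ESum a b => (maxn (scratch_space a) (scratch_space b)).+2
  | EIter n a b c =>
      (maxn (maxn (scratch_space n) (scratch_space a))
            (maxn (scratch_space b) (scratch_space c))).+4.+1
  | EDrop a => scratch_space a
  end.

(** The old value of [out] enters the time bound because appending to a unary counter takes time
    linear in its length. *)
Definition compiles_within (e : expr) (tb : nat -> nat) :=
  forall x s vars out fr, all (fun v => v < fr) vars -> out < fr -> out \notin vars ->
  fr + scratch_space e <= C -> (forall i, fr <= i -> s i = 0) ->
  cruns C x (compile e vars out fr) s (setc s out (s out + eval x e (map s vars)))
    (tb (size x + sumn (map s vars) + s out)).

Lemma setc_eq s j v : setc s j v j = v.
Proof. by rewrite /setc eqxx. Qed.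

Lemma setc_ne s j v i : i <> j -> setc s j v i = s i.
Proof. by rewrite /setc; case: eqP. Qed.

Lemma all_ltW vars a b : a <= b -> all (fun v => v < a) vars -> all (fun v => v < b) vars.
Proof. by move=> hab; apply: sub_all => v /leq_trans; apply. Qed.

Lemma notin_ge vars fr j : all (fun v => v < fr) vars -> fr <= j -> j \notin vars.
Proof. by move=> /allP h hj; apply/negP => /h; lia. Qed.

Lemma compile_var i : exists2 tb, poly tb & compiles_within (EVar i) tb.
Proof.
exists (fun n => 2 * lcost C n).
  by have h := poly_lcost C; poly_tac.
move=> x s vars out fr hv ho hn /= hC hs.
case: ltnP => hi; last first.
  rewrite nth_default ?size_map // addn0.
  by apply: cruns_conv (@cruns_skip _ _ _) _ _ => //; st_tac.
rewrite (nth_map 0) //.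
have hm : nth 0 vars i \in vars by rewrite mem_nth.
have hlt : nth 0 vars i < fr by apply: (allP hv).
have hb : s (nth 0 vars i) <= sumn (map s vars).
  elim: (vars) i hi {hn hv hm hlt} => //= u w IH [|i] hi //=; first by rewrite leq_addr.
  by apply: leq_trans (IH i hi) _; rewrite leq_addl.
apply: cruns_copy; try lia.
- by move=> e; move: hn; rewrite -e hm.
- by rewrite hs.
Qed.

Lemma compile_const c : exists2 tb, poly tb & compiles_within (EConst c) tb.
Proof.
exists (fun n => c * cost (n + c)).
  by have h := poly_op_cost C.+1; poly_tac.
move=> x s vars out fr hv ho hn /= hC hs.
apply: cruns_conv (cruns_incs _ _) _ _ => //; first by lia.
by rewrite leq_mul2l; apply/orP; right; apply: cost_le; lia.
Qed.

Lemma compile_bit a :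
  (exists2 tb, poly tb & compiles_within a tb) -> exists2 tb, poly tb & compiles_within (EBit a) tb.
Proof.
move=> [ta pa ha]; have [va pv hva] := eval_poly a.
exists (fun n => ta n + ((2 * cost n.+1 + cost (va n)) + lcost C (va n))).
  by have h := poly_op_cost C.+1; have h' := poly_lcost C; poly_tac.
move=> x s vars out fr hv ho hn /= hC hs.
have h0 : s fr = 0 by apply: hs.
set N := size x + sumn (map s vars) + s out.
have hN : size x + sumn (map s vars) <= N by rewrite leq_addr.
have hvN : eval x a (map s vars) <= va N by apply: leq_trans (hva _ _) _; apply: poly_mono.
apply: cruns_conv.
- apply: cruns_seq.
    apply: ha; [exact: all_ltW hv | by [] | exact: notin_ge hv _ | by lia | ].
    by move=> i hi; apply: hs; lia.
  apply: cruns_seq; first by apply: cruns_read; lia.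
  apply: (cruns_clear (B := va N)); first by lia.
  by rewrite setc_ne ?setc_eq ?h0; lia.
- by st_tac; rewrite ?h0 ?add0n.
- apply: leq_add; first by apply: poly_mono => //; rewrite h0; lia.
  rewrite -/N leq_add2r; apply: leq_add; last by apply: cost_le; rewrite setc_eq h0.
  by rewrite leq_mul2l; apply/orP; right; apply: cost_le; rewrite setc_ne /N; lia.
Qed.

Lemma map_setc s j v vars : j \notin vars -> map (setc s j v) vars = map s vars.
Proof. by move=> h; apply/eq_in_map => i hi; rewrite setc_ne // => e; rewrite -e hi in h. Qed.

Ltac cost_tac := apply: cost_le; get_tac.

Lemma compile_len : exists2 tb, poly tb & compiles_within ELen tb.
Proof.
exists (fun n => 2 * cost 1 + cost 0 + (n * (lcost C 2 + (cost n + (cost n + (2 * cost 1 + cost n))) + cost 0) + cost 0 + lcost C n)).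
  by have h := poly_op_cost C.+1; have h' := poly_lcost C; poly_tac.
move=> x s vars out fr hv ho hn /= hC hs.
have h0 : s fr = 0 by apply: hs.
have h1 : s fr.+1 = 0 by apply: hs; lia.
set N := size x + sumn (map s vars) + s out.
(* The test counter holds the code of symbol [i]; this is positive for every symbol and 0 past the
   end, which stops the loop after [size x] rounds. *)
pose St i := setc (setc (setc s fr i) fr.+1 (bit_code (onth x i))) out (s out + i).
apply: cruns_conv.
- apply: cruns_seq; first by apply: cruns_read; lia.
  apply: cruns_seq.
    apply: (@cruns_while C x _ _ St (size x) (lcost C 2 + (cost N + (cost N + (2 * cost 1 + cost N)))) _ (St (size x))) => //; try lia.
    + move=> i hi; split.
        rewrite /St setc_ne; last lia; rewrite setc_eq.
        by have := onthTE x i; rewrite hi; case: (onth x i) => // -[].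
      apply: cruns_conv.
      * apply: cruns_seq.
          apply: (cruns_clear (B := 2)); first by lia.
          by rewrite /St setc_ne ?setc_eq; last lia; case: onth => [[]|].
        apply: cruns_seq; first by apply: cruns_inc; lia.
        apply: cruns_seq; first by apply: cruns_inc; lia.
        by apply: cruns_read; lia.
      * by rewrite /St; st_tac.
      * rewrite /St; apply: leq_add => //; apply: leq_add; first by cost_tac.
        apply: leq_add; first by cost_tac.
        apply: leq_add; last by cost_tac.
        by rewrite leq_mul2l; apply/orP; right; cost_tac.
    + by rewrite /St setc_ne ?setc_eq ?onth_default //; lia.
    + by rewrite /St; st_tac; rewrite ?h0 ?h1.
  apply: (cruns_clear (B := N)); first by lia.
  by rewrite /St setc_ne; last lia; rewrite setc_ne ?setc_eq /N; lia.
- by rewrite /St; st_tac; rewrite ?onth_default ?h1.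
- rewrite h0 h1 -/N leq_add2l !leq_add2r leq_mul2r; apply/orP; right; rewrite /N; lia.
Qed.

Lemma compile_add a b :
  (exists2 tb, poly tb & compiles_within a tb) ->
  (exists2 tb, poly tb & compiles_within b tb) ->
  exists2 tb, poly tb & compiles_within (EAdd a b) tb.
Proof.
move=> [ta pa ha] [tb pb hb]; have [va pv hva] := eval_poly a.
exists (fun n => ta n + tb (n + va n)); first by poly_tac.
move=> x s vars out fr hv ho hn /= hC hs.
apply: cruns_conv.
- apply: cruns_seq; first by apply: ha => //; lia.
  apply: hb => //; first by lia.
  by move=> i hi; rewrite setc_ne ?hs; lia.
- by rewrite map_setc //; st_tac.
- rewrite map_setc // setc_eq leq_add2l; apply: poly_mono => //.
  have := hva x (map s vars).
  have : va (size x + sumn (map s vars)) <= va (size x + sumn (map s vars) + s out).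
    by apply: poly_mono; rewrite ?leq_addr.
  by lia.
Qed.

Lemma compile_sub a b :
  (exists2 tb, poly tb & compiles_within a tb) ->
  (exists2 tb, poly tb & compiles_within b tb) ->
  exists2 tb, poly tb & compiles_within (ESub a b) tb.
Proof.
move=> [ta pa ha] [tb pb hb]; have [va pva hva] := eval_poly a; have [vb pvb hvb] := eval_poly b.
exists (fun n => ta n + (tb n + (vb n * (cost (vb n) + cost (va n) + cost 0) + cost 0 + lcost C (n + va n)))).
  by have h := poly_op_cost C.+1; have h' := poly_lcost C; poly_tac.
move=> x s vars out fr hv ho hn /= hC hs.
have h0 : s fr = 0 by apply: hs.
have h1 : s fr.+1 = 0 by apply: hs; lia.
have nfr : fr \notin vars by apply: notin_ge hv _.
have nfr1 : fr.+1 \notin vars by apply: notin_ge hv _.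
set N := size x + sumn (map s vars) + s out.
have hN : size x + sumn (map s vars) <= N by rewrite leq_addr.
have hva' : eval x a (map s vars) <= va N by apply: leq_trans (hva _ _) _; apply: poly_mono.
have hvb' : eval x b (map s vars) <= vb N by apply: leq_trans (hvb _ _) _; apply: poly_mono.
set u := eval x a _ in hva' *; set w := eval x b _ in hvb' *.
pose St i := setc (setc s fr (u - i)) fr.+1 (w - i).
apply: cruns_conv.
- apply: cruns_seq.
    apply: ha; [by apply: all_ltW hv; lia | by lia | by [] | by lia | ].
    by move=> i hi; apply: hs; lia.
  apply: cruns_seq.
    apply: hb; [by apply: all_ltW hv; lia | by [] | by [] | by lia | ].
    by move=> i hi; rewrite setc_ne ?hs; lia.
  apply: cruns_seq.
    apply: (@cruns_while C x _ _ St w (cost (vb N) + cost (va N)) _ (St w)) => //; try lia.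
    + move=> i hi; split; first by rewrite /St setc_eq; lia.
      apply: cruns_conv.
      * by apply: cruns_seq; apply: cruns_dec; lia.
      * by rewrite /St; st_tac.
      * by rewrite /St; apply: leq_add; cost_tac.
    + by rewrite /St setc_eq subnn.
    + by rewrite /St map_setc // -/w -/u h0; st_tac; rewrite ?h1.
  apply: (@cruns_move C x _ fr out (N + va N)); try lia.
  by rewrite /St /setc; repeat (case: eqP => ?; subst); try lia; rewrite /N; lia.
- by rewrite /St; st_tac.
- rewrite map_setc // !setc_ne; try lia; rewrite h0 h1 addn0.
  apply: leq_add; first by apply: poly_mono.
  apply: leq_add; first by apply: poly_mono.
  by rewrite leq_add2r leq_add2r leq_mul2r hvb' orbT.
Qed.

Lemma compile_drop a :
  (exists2 tb, poly tb & compiles_within a tb) -> exists2 tb, poly tb & compiles_within (EDrop a) tb.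
Proof.
move=> [ta pa ha]; exists ta => // x s vars out fr hv ho hn /= hC hs.
rewrite behead_map; apply: cruns_conv; first apply: ha (fr) _ _ _ _ _ => //.
- by apply/allP => v /mem_behead; apply: (allP hv).
- by apply: contra hn; apply: mem_behead.
- by [].
- by apply: poly_mono => //; case: (vars) => //= u w; lia.
Qed.

Lemma compile_sum n b :
  (exists2 tb, poly tb & compiles_within n tb) ->
  (exists2 tb, poly tb & compiles_within b tb) ->
  exists2 tb, poly tb & compiles_within (ESum n b) tb.
Proof.
move=> [tn pn hn] [tb pb hb]; have [vn pvn hvn] := eval_poly n; have [vb pvb hvb] := eval_poly b.
(* [M] bounds the argument of [tb] in every round: the initial measure, the summation index, and the
   partial sum accumulated on [out]. *)
pose M k := k + vn k + vn k * vb (k + vn k).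
have pM : poly M by rewrite /M; poly_tac.
exists (fun k => tn k + (vn k * (cost (vn k) + (tb (M k) + cost (vn k)) + cost 0) + cost 0 + lcost C (vn k))).
  by have h := poly_op_cost C.+1; have h' := poly_lcost C; poly_tac.
move=> x s vars out fr hv ho hno /= hC hs.
have h0 : s fr = 0 by apply: hs.
have h1 : s fr.+1 = 0 by apply: hs; lia.
have nfr : fr \notin vars by apply: notin_ge hv _.
have nfr1 : fr.+1 \notin vars by apply: notin_ge hv _.
set N := size x + sumn (map s vars) + s out.
have hN : size x + sumn (map s vars) <= N by rewrite leq_addr.
have hvn' : eval x n (map s vars) <= vn N by apply: leq_trans (hvn _ _) _; apply: poly_mono.
set w := eval x n _ in hvn' *.
pose F i := \sum_(j < i) eval x b ((j : nat) :: map s vars).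
have hF i : i <= w -> F i <= vn N * vb (N + vn N).
  move=> hi; apply: leq_trans (_ : \sum_(j < i) vb (N + vn N) <= _).
    apply: leq_sum => j _; apply: leq_trans (hvb _ _) _; apply: poly_mono => //=.
    by have := ltn_ord j; lia.
  by rewrite sum_nat_const card_ord leq_mul2r; apply/orP; right; lia.
pose St i := setc (setc (setc s fr (w - i)) fr.+1 i) out (s out + F i).
have mSt i : map (setc (St i) fr (St i fr).-1) vars = map s vars.
  by rewrite map_setc // /St map_setc // map_setc // map_setc.
apply: cruns_conv.
- apply: cruns_seq.
    apply: hn; [by apply: all_ltW hv; lia | by lia | by [] | by lia | ].
    by move=> i hi; apply: hs; lia.
  apply: cruns_seq.
    apply: (@cruns_while C x _ _ St w (cost (vn N) + (tb (M N) + cost (vn N))) _ (St w)) => //; try lia.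
    + move=> i hi; split; first by rewrite /St; get_tac.
      apply: cruns_conv.
      * apply: cruns_seq; first by apply: cruns_dec; lia.
        apply: cruns_seq.
          apply: hb => /=.
          - by rewrite ltnSn; apply: all_ltW hv; lia.
          - by lia.
          - by rewrite inE negb_or hno andbT; lia.
          - by lia.
          - by move=> j hj; rewrite /St; get_tac; apply: hs; lia.
        by apply: cruns_inc; lia.
      * rewrite /= mSt (_ : setc (St i) _ _ fr.+1 = i); last by rewrite /St; get_tac.
        rewrite /St => c; rewrite /F big_ord_recr /=; move: c; st_tac.
      * rewrite /= mSt (_ : setc (St i) _ _ fr.+1 = i); last by rewrite /St; get_tac.
        apply: leq_add; first by rewrite /St; cost_tac.
        apply: leq_add; last by rewrite /St; cost_tac.
        apply: poly_mono => //; rewrite (_ : setc _ _ _ out = s out + F i); last by rewrite /St; get_tac.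
        have eN : size x + sumn (map s vars) + s out = N by [].
        by rewrite /M; have := hF i (ltnW hi); lia.
    + by rewrite /St; get_tac.
    + by rewrite /St -/w /F big_ord0 h0; st_tac; rewrite ?h1.
  apply: (cruns_clear (B := vn N)); first by lia.
  by rewrite /St setc_ne ?setc_eq //; lia.
- by rewrite /St /F; st_tac.
- apply: leq_add; first by rewrite h0; apply: poly_mono => //; lia.
  by rewrite !leq_add2r leq_mul2r hvn' orbT.
Qed.

Lemma compile_iter n a b c :
  (exists2 tb, poly tb & compiles_within n tb) ->
  (exists2 tb, poly tb & compiles_within a tb) ->
  (exists2 tb, poly tb & compiles_within b tb) ->
  (exists2 tb, poly tb & compiles_within c tb) ->
  exists2 tb, poly tb & compiles_within (EIter n a b c) tb.
Proof.
move=> [tn pn hn] [ta pa ha] [tb pb hb] [tc pc hc].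
have [vn pvn hvn] := eval_poly n; have [va pva hva] := eval_poly a.
have [vb pvb hvb] := eval_poly b; have [vc pvc hvc] := eval_poly c.
(* [Q] bounds the accumulator, which is the initial value or a truncated one, and [W] the value of
   the body before truncation. *)
pose Q k := va k + vc k.
pose W k := vb (k + vn k + Q k).
pose body_cost k := cost (vn k) + (tb (k + vn k + Q k) + (lcost C (Q k) + (tc k +
  ((W k * (cost (W k) + (cost (vc k) + cost (W k) + cost 0) + cost 0) + cost 0) +
   (lcost C (vc k) + cost (vn k)))))).
exists (fun k => tn k + (ta k + ((vn k * (body_cost k + cost 0) + cost 0) +
   (lcost C (vn k) + lcost C (k + Q k))))).
  have h := poly_op_cost C.+1; have h' := poly_lcost C; rewrite /body_cost /W /Q; poly_tac.
move=> x s vars out fr hv ho hno /= hC hs.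
have h0 : s fr = 0 by apply: hs.
have h1 : s fr.+1 = 0 by apply: hs; lia.
have h2 : s fr.+2 = 0 by apply: hs; lia.
have h3 : s fr.+3 = 0 by apply: hs; lia.
have h4 : s fr.+4 = 0 by apply: hs; lia.
have nge j : fr <= j -> j \notin vars by apply: notin_ge hv.
set N := size x + sumn (map s vars) + s out.
have hN : size x + sumn (map s vars) <= N by rewrite leq_addr.
have hn' : eval x n (map s vars) <= vn N by apply: leq_trans (hvn _ _) _; apply: poly_mono.
have ha' : eval x a (map s vars) <= va N by apply: leq_trans (hva _ _) _; apply: poly_mono.
have hc' : eval x c (map s vars) <= vc N by apply: leq_trans (hvc _ _) _; apply: poly_mono.
set w := eval x n _ in hn' *; set u := eval x a _ in ha' *; set d := eval x c _ in hc' *.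
pose F i := iteri i (fun i acc => minn (eval x b [:: i, acc & map s vars]) d) u.
have hF i : F i <= Q N.
  by case: i => [|i]; rewrite /F /Q /=; [lia | apply: leq_trans (geq_minr _ _) _; lia].
pose St i := setc (setc (setc s fr (w - i)) fr.+1 i) fr.+2 (F i).
have vN k k' : k <= k' -> vn k <= vn k' by apply: poly_mono.
apply: cruns_conv.
- apply: cruns_seq.
    apply: hn; [by apply: all_ltW hv; lia | by lia | by apply: nge | by lia | ].
    by move=> i hi; apply: hs; lia.
  apply: cruns_seq.
    apply: ha; [by apply: all_ltW hv; lia | by lia | by apply: nge; lia | by lia | ].
    by move=> i hi; rewrite setc_ne ?hs; lia.
  apply: cruns_seq.
    apply: (@cruns_while C x _ _ St w (body_cost N) _ (St w)) => //; try lia.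
    + move=> i hi; split; first by rewrite /St; get_tac.
      set s1 := setc (St i) fr (St i fr).-1.
      have mS1 : map s1 vars = map s vars by rewrite /s1 /St; do !(rewrite map_setc; last by apply: nge; lia).
      set e := eval x b [:: i, F i & map s vars].
      have he : e <= W N.
        apply: leq_trans (hvb _ _) _; apply: poly_mono => //=.
        by have := hF i; lia.
      pose s2 := setc s1 fr.+3 e.
      pose s3 := setc s2 fr.+2 0.
      have mS3 : map s3 vars = map s vars by rewrite /s3 /s2; do !(rewrite map_setc; last by apply: nge; lia).
      pose s4 := setc s3 fr.+4 d.
      (* The inner loop computes a minimum: [o] and [o'] go down together, and the accumulator
         counts the rounds in which [o'] was still positive. *)
      pose Sq j := setc (setc (setc s4 fr.+3 (e - j)) fr.+4 (d - j)) fr.+2 (minn j d).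
      apply: cruns_conv.
      * apply: cruns_seq; first by apply: cruns_dec; lia.
        apply: cruns_seq.
          apply: hb => /=.
          - by apply/and3P; split; [lia | lia | apply: all_ltW hv; lia].
          - by lia.
          - by rewrite !inE !negb_or nge ?andbT; lia.
          - by lia.
          - by move=> j hj; rewrite /St; get_tac; apply: hs; lia.
        rewrite -/s1 /= mS1 (_ : s1 fr.+1 = i); last by rewrite /s1 /St; get_tac.
        rewrite (_ : s1 fr.+2 = F i); last by rewrite /s1 /St; get_tac.
        rewrite -/e (_ : s1 fr.+3 = 0); last by rewrite /s1 /St; get_tac.
        rewrite add0n -/s2.
        apply: cruns_seq.
          apply: (cruns_clear (B := Q N)); first by lia.
          by rewrite /s2 /s1 /St; get_tac; apply: hF.
        rewrite -/s3.
        apply: cruns_seq.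
          apply: hc; [by apply: all_ltW hv; lia | by lia | by apply: nge; lia | by lia | ].
          by move=> j hj; rewrite /s3 /s2 /s1 /St; get_tac; apply: hs; lia.
        rewrite mS3 -/d (_ : s3 fr.+4 = 0); last by rewrite /s3 /s2 /s1 /St; get_tac.
        rewrite add0n -/s4.
        apply: cruns_seq.
          apply: (@cruns_while C x _ _ Sq e (cost (W N) + (cost (vc N) + cost (W N) + cost 0)) _ (Sq e)) => //; try lia.
          - move=> j hj; split; first by rewrite /Sq; get_tac.
            apply: cruns_conv.
            + apply: cruns_seq; first by apply: cruns_dec; lia.
              apply: (@cruns_if C x _ _ _ _ (Sq j.+1) (cost (vc N) + cost (W N))); first by lia.
              case: eqP => hz.
                apply: cruns_conv (@cruns_skip _ _ _) _ _ => //.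
                have {}hz : d - j = 0 by rewrite -hz /Sq; get_tac.
                by rewrite /Sq; st_tac.
              have {}hz : 0 < d - j.
                by move: hz; rewrite /Sq; repeat (rewrite setc_ne; last lia); rewrite ?setc_eq; lia.
              apply: cruns_conv.
              * by apply: cruns_seq; [apply: cruns_dec | apply: cruns_inc]; lia.
              * by rewrite /Sq; st_tac.
              * by apply: leq_add; rewrite /Sq; cost_tac.
            + by [].
            + by rewrite leq_add2r /Sq; cost_tac.
          - by rewrite /Sq; get_tac.
          - by rewrite /Sq /s4 /s3 /s2; st_tac.
        apply: cruns_seq.
          apply: (cruns_clear (B := vc N)); first by lia.
          by rewrite /Sq; get_tac.
        by apply: cruns_inc; lia.
      * by rewrite /Sq /s4 /s3 /s2 /s1 /St /F /= -/(F i) -/e; st_tac; rewrite ?h3 ?h4 //; lia.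
      * rewrite /body_cost; apply: leq_add; first by rewrite /St; cost_tac.
        apply: leq_add.
          apply: poly_mono => //=; rewrite -/s1 mS1.
          rewrite (_ : s1 fr.+1 = i); last by rewrite /s1 /St; get_tac.
          rewrite (_ : s1 fr.+2 = F i); last by rewrite /s1 /St; get_tac.
          rewrite (_ : s1 fr.+3 = 0); last by rewrite /s1 /St; get_tac.
          by have := hF i; lia.
        rewrite leq_add2l; apply: leq_add.
          apply: poly_mono => //; rewrite mS3 (_ : s3 fr.+4 = 0) ?addn0 //.
          by rewrite /s3 /s2 /s1 /St; get_tac.
        apply: leq_add; first by rewrite leq_add2r leq_mul2r he orbT.
        rewrite leq_add2l /Sq /s4 /s3 /s2 /s1 /St; cost_tac.
    + by rewrite /St; get_tac.
    + by rewrite map_setc ?nge // -/w -/u /St /F /= h0; st_tac; rewrite ?h1 ?h2.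
  apply: cruns_seq.
    apply: (cruns_clear (B := vn N)); first by lia.
    by rewrite /St; get_tac.
  apply: (@cruns_move C x _ fr.+2 out (N + Q N)); try lia.
  have := hF w; rewrite /St /setc; repeat (case: eqP => ?; subst); try lia; rewrite /N; lia.
- by rewrite /St; st_tac; rewrite ?h2.
- apply: leq_add; first by rewrite h0; apply: poly_mono => //; lia.
  apply: leq_add.
    rewrite map_setc ?nge // setc_ne ?h2; last lia; apply: poly_mono => //; lia.
  by rewrite leq_add2r leq_add2r leq_mul2r hn' orbT.
Qed.

Lemma compile_expr e : exists2 tb, poly tb & compiles_within e tb.
Proof.
elim: e => *.
- exact: compile_var.
- exact: compile_const.
- exact: compile_bit.
- exact: compile_len.
- exact: compile_add.
- exact: compile_sub.
- exact: compile_sum.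
- exact: compile_iter.
- exact: compile_drop.
Qed.

End Compilation.

Lemma expr_decidable (e : expr) : exists M c d, forall x,
  decides_within M x (eval x e [::] <> 0) (c * size x ^ d + c).
Proof.
pose C := 1 + scratch_space e.
have [tb ptb hrun] := compile_expr C e.
pose T n := n.+1 * (2 * op_cost C.+1 n + 8) + (tb n + (C.+1).+2).
have [|c [d hT]] := @poly_bound (fun n => (T n).+1).
  by have h := poly_op_cost C.+1; rewrite /T; poly_tac.
(* The output is counter 0, on track 1. The head finally stands on the first cell of that track,
   which contains [Some true] exactly if the value is nonzero. *)
exists (tm_of_prog (load_input C.+1 ;; compile C e [::] 0 1 ;; goto_top C.+1 1)), c, d => x.
have [f1 [n1 [e1 l1 r1]]] := @exec_load_input C.+1 isT x.
have hr1 : holds_tracks C.+1 (counter_tracks x (fun=> 0)) f1.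
  by move=> j i hj; rewrite r1 //; case: j hj.
have [f2 [n2 [e2 l2 r2 _]]] :=
  hrun x (fun=> 0) [::] 0 1 isT isT isT (leqnn _) (fun _ _ => erefl) f1 hr1.
apply: (@tm_of_prog_decides _ x f2 (cell C.+1 1 1) (n1 + (n2 + (2 + C.+1)))).
- apply: ExSeq; first by exact: e1.
  apply: ExSeq; first by exact: e2.
  by apply: exec_goto_top.
- by apply: leq_trans (hT (size x)); move: l1 l2; rewrite /= !addn0 /T; lia.
- rewrite r2 //= setc_eq add0n; case: (eval x e [::]) => [|v] /=; first by split.
  by split.
Qed.

(** * Functions definable by expressions *)

Definition definable (f : seq bool -> seq nat -> nat) : Prop :=
  exists e, forall x env, eval x e env = f x env.

Definition sumb (n : nat) (F : nat -> nat) := sumn (map F (iota 0 n)).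
Definition allb (n : nat) (P : nat -> bool) := all P (iota 0 n).
Definition exb (n : nat) (P : nat -> bool) := has P (iota 0 n).
Definition countb (n : nat) (P : nat -> bool) := count P (iota 0 n).
Definition iterb (n : nat) (F : nat -> nat -> nat) (a B : nat) :=
  iteri n (fun i acc => minn (F i acc) B) a.

Lemma allP_b n (P : nat -> bool) : reflect (forall i, i < n -> P i) (allb n P).
Proof.
by apply: (iffP allP) => h i hi; apply: h; move: hi; rewrite mem_iota.
Qed.

Lemma exP_b n (P : nat -> bool) : reflect (exists2 i, i < n & P i) (exb n P).
Proof.
by apply: (iffP hasP) => -[i hi hP]; exists i => //; move: hi; rewrite mem_iota.
Qed.

Lemma sumbE n F : sumb n F = \sum_(i < n) F i.
Proof. by rewrite /sumb sumnE big_map -{1}(subn0 n) -/(index_iota 0 n) big_mkord. Qed.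

Lemma countbE n (P : nat -> bool) : countb n P = sumb n (fun i => P i).
Proof. by rewrite /countb /sumb; elim: (iota 0 n) => //= i s ->. Qed.

Definition is_tail (t : seq nat -> seq nat) := exists n, forall env, t env = iter n behead env.

Lemma tail_id : is_tail (fun env => env).
Proof. by exists 0. Qed.

Lemma tail_behead t : is_tail t -> is_tail (fun env => behead (t env)).
Proof. by move=> [n h]; exists n.+1 => env /=; rewrite h. Qed.

(** Weakening: one [EDrop] for each binder crossed. It lets a function shown definable once be used
    under any number of sums and iterations. *)
Lemma def_tail a t : definable a -> is_tail t -> definable (fun x env => a x (t env)).
Proof.
move=> [e he] [n ht]; exists (iter n EDrop e) => x env; rewrite ht -he.
by elim: n {t ht} e {he} env => [|n IH] e env //=; rewrite IH -iterSr.
Qed.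

Lemma def_head t : is_tail t -> definable (fun x env => head 0 (t env)).
Proof. by apply: (@def_tail (fun x env => head 0 env)); exists (EVar 0) => x env /=; rewrite nth0. Qed.

Lemma def_const c : definable (fun x env => c).
Proof. by exists (EConst c). Qed.

Lemma def_size : definable (fun x env => size x).
Proof. by exists ELen. Qed.

Lemma def_ext f g : (forall x env, f x env = g x env) -> definable f -> definable g.
Proof. by move=> h [e he]; exists e => x env; rewrite he h. Qed.

Section Closure.

Variables a b c : seq bool -> seq nat -> nat.
Hypotheses (ha : definable a) (hb : definable b) (hc : definable c).

Lemma def_bit : definable (fun x env => bit_code (onth x (a x env))).
Proof. by case: ha => e he; exists (EBit e) => x env /=; rewrite he. Qed.

Lemma def_add : definable (fun x env => a x env + b x env).
Proof. by case: ha hb => e he [e' he']; exists (EAdd e e') => x env /=; rewrite he he'. Qed.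

Lemma def_sub : definable (fun x env => a x env - b x env).
Proof. by case: ha hb => e he [e' he']; exists (ESub e e') => x env /=; rewrite he he'. Qed.

Lemma def_sum (F : seq bool -> seq nat -> nat -> nat) :
  definable (fun x env => F x (behead env) (head 0 env)) ->
  definable (fun x env => sumb (a x env) (F x env)).
Proof.
case: ha => e he [e' he']; exists (ESum e e') => x env /=.
by rewrite he sumbE; apply: eq_bigr => i _; rewrite he'.
Qed.

Lemma def_iter (F : seq bool -> seq nat -> nat -> nat -> nat) :
  definable (fun x env => F x (behead (behead env)) (head 0 env) (head 0 (behead env))) ->
  definable (fun x env => iterb (a x env) (F x env) (b x env) (c x env)).
Proof.
case: ha hb hc => e1 he1 [e2 he2] [e3 he3] [e' he'].
exists (EIter e1 e2 e' e3) => x env /=; rewrite he1 he2.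
by apply: eq_iteri => i acc; rewrite he' he3.
Qed.

End Closure.

Lemma def_succ a : definable a -> definable (fun x env => (a x env).+1).
Proof. by move=> ha; apply: def_ext (def_add ha (def_const 1)) => x env; rewrite addn1. Qed.

Lemma def_mul a b : definable a -> definable b -> definable (fun x env => a x env * b x env).
Proof.
move=> ha hb.
apply: def_ext (def_sum ha (F := fun x env _ => b x env) (def_tail hb (tail_behead tail_id))) => x env.
by rewrite sumbE sum_nat_const card_ord.
Qed.

Lemma def_not (P : seq bool -> seq nat -> bool) :
  definable (fun x env => P x env) -> definable (fun x env => ~~ P x env).
Proof.
by move=> h; apply: def_ext (def_sub (def_const 1) h) => x env; case: (P x env).
Qed.

Section Connectives.

Variables P Q : seq bool -> seq nat -> bool.
Hypotheses (hP : definable (fun x env => P x env)) (hQ : definable (fun x env => Q x env)).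

Lemma def_and : definable (fun x env => P x env && Q x env).
Proof. by apply: def_ext (def_mul hP hQ) => x env; rewrite mulnb. Qed.

Lemma def_or : definable (fun x env => P x env || Q x env).
Proof.
apply: def_ext (def_sub (def_add hP hQ) (def_mul hP hQ)) => x env.
by case: (P x env); case: (Q x env).
Qed.

Lemma def_imp : definable (fun x env => P x env ==> Q x env).
Proof.
apply: def_ext (def_sub (def_const 1) (def_sub hP hQ)) => x env.
by case: (P x env); case: (Q x env).
Qed.

End Connectives.

Lemma def_le a b : definable a -> definable b -> definable (fun x env => a x env <= b x env).
Proof.
move=> ha hb; apply: def_ext (def_sub (def_const 1) (def_sub ha hb)) => x env.
by rewrite /leq; case: (a x env - b x env).
Qed.

Lemma def_eq a b : definable a -> definable b -> definable (fun x env => a x env == b x env).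
Proof.
by move=> ha hb; apply: def_ext (def_and (def_le ha hb) (def_le hb ha)) => x env; rewrite eqn_leq.
Qed.

Lemma def_count a (P : seq bool -> seq nat -> nat -> bool) :
  definable a -> definable (fun x env => P x (behead env) (head 0 env)) ->
  definable (fun x env => countb (a x env) (P x env)).
Proof.
move=> ha hP; apply: def_ext (def_sum ha hP) => x env.
by rewrite countbE.
Qed.

Lemma def_ex a (P : seq bool -> seq nat -> nat -> bool) :
  definable a -> definable (fun x env => P x (behead env) (head 0 env)) ->
  definable (fun x env => exb (a x env) (P x env)).
Proof.
move=> ha hP; apply: def_ext (def_le (def_const 1) (def_count ha hP)) => x env.
by rewrite /exb has_count.
Qed.

Lemma def_all a (P : seq bool -> seq nat -> nat -> bool) :
  definable a -> definable (fun x env => P x (behead env) (head 0 env)) ->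
  definable (fun x env => allb (a x env) (P x env)).
Proof.
move=> ha hP; apply: def_ext (def_not (def_ex ha (P := fun x env i => ~~ P x env i) (def_not hP))) => x env.
by rewrite /exb has_predC negbK.
Qed.

Ltac def_user := fail.

Ltac tail_tac := repeat first [exact: tail_id | apply: tail_behead].

Ltac def_step := cbv beta; match goal with
  | |- definable (fun x env => ?c) => exact: def_const
  | |- definable (fun x env => size x) => exact: def_size
  | |- definable (fun x env => head 0 (@?t env)) => apply: (@def_head t); tail_tac
  | H : definable ?a |- definable ?a => exact: H
  | H : definable ?a |- definable (fun x env => ?a x (@?t env)) => apply: (@def_tail a t H); tail_tac
  | _ => def_user
  | |- definable (fun x env => bit_code (onth x (@?a x env))) => apply: (@def_bit a)
  | |- definable (fun x env => (@?a x env) + (@?b x env)) => apply: (@def_add a b)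
  | |- definable (fun x env => (@?a x env) - (@?b x env)) => apply: (@def_sub a b)
  | |- definable (fun x env => (@?a x env) * (@?b x env)) => apply: (@def_mul a b)
  | |- definable (fun x env => S (@?a x env)) => apply: (@def_succ a)
  | |- definable (fun x env => sumb (@?a x env) (@?F x env)) => apply: (@def_sum a _ F)
  | |- definable (fun x env => countb (@?a x env) (@?F x env)) => apply: (@def_count a F)
  | |- definable (fun x env => iterb (@?a x env) (@?F x env) (@?b x env) (@?c x env)) =>
      apply: (@def_iter a b c _ _ _ F)
  | |- definable (fun x env => nat_of_bool (~~ (@?P x env))) => apply: (@def_not P)
  | |- definable (fun x env => nat_of_bool ((@?P x env) && (@?Q x env))) => apply: (@def_and P Q)
  | |- definable (fun x env => nat_of_bool ((@?P x env) || (@?Q x env))) => apply: (@def_or P Q)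
  | |- definable (fun x env => nat_of_bool ((@?P x env) ==> (@?Q x env))) => apply: (@def_imp P Q)
  | |- definable (fun x env => nat_of_bool ((@?a x env) <= (@?b x env))) => apply: (@def_le a b)
  | |- definable (fun x env => nat_of_bool ((@?a x env) == (@?b x env))) => apply: (@def_eq a b)
  | |- definable (fun x env => nat_of_bool (allb (@?a x env) (@?F x env))) => apply: (@def_all a F)
  | |- definable (fun x env => nat_of_bool (exb (@?a x env) (@?F x env))) => apply: (@def_ex a F)
  end.

Ltac def_tac := repeat def_step.

(** The quotient is the number of [q] for which [q.+1] copies of the divisor fit; the conjunct
    [0 < b x env] yields the conventional value 0 for divisor 0. *)
Lemma def_div a b : definable a -> definable b -> definable (fun x env => a x env %/ b x env).
Proof.
move=> ha hb.
apply: (@def_ext (fun x env => countb (a x env)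
  (fun q => (0 < b x env) && (q.+1 * b x env <= a x env)))); last by def_tac.
move=> x env; set m := a x env; set d := b x env.
case: (posnP d) => [->|d0]; first by rewrite divn0 /countb count_pred0.
have e : iota 0 m = iota 0 (m %/ d) ++ iota (m %/ d) (m - m %/ d).
  by rewrite -{1}(subnKC (leq_div m d)) iotaD.
rewrite /countb e count_cat /=.
have -> : count (fun q => q.+1 * d <= m) (iota 0 (m %/ d)) = m %/ d.
  rewrite -[RHS](size_iota 0 (m %/ d)); apply/eqP; rewrite -all_count; apply/allP => q.
  by rewrite mem_iota add0n /= -leq_divRL.
rewrite (_ : count _ (iota (m %/ d) _) = 0) ?addn0 //.
apply/eqP; rewrite -leqn0 leqNgt -has_count; apply/hasPn => q.
by rewrite mem_iota -leq_divRL // -ltnNge ltnS => /andP[].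
Qed.

Lemma def_mod a b : definable a -> definable b -> definable (fun x env => a x env %% b x env).
Proof.
move=> ha hb.
apply: (@def_ext (fun x env => a x env - a x env %/ b x env * b x env)) => [x env|].
  by rewrite {1}(divn_eq (a x env) (b x env)) addKn.
by apply: def_sub => //; apply: def_mul => //; apply: def_div.
Qed.

(** The exponent is a constant outside the expression language. This is the place where [k] must be
    fixed: an exponent read from the input would exceed every polynomial. *)
Lemma def_exp a c : definable a -> definable (fun x env => a x env ^ c).
Proof.
move=> ha; elim: c => [|c IH]; first by apply: def_ext (def_const 1) => x env; rewrite expn0.
by apply: def_ext (def_mul ha IH) => x env; rewrite expnS.
Qed.

Definition digit (b N p : nat) := iter p (fun v => v %/ b) N %% b.

Lemma def_digit a b c : definable a -> definable b -> definable c ->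
  definable (fun x env => digit (a x env) (b x env) (c x env)).
Proof.
move=> ha hb hc; apply: def_mod => //.
(* Truncation by the dividend itself changes nothing, since successive quotients never exceed it. *)
apply: (@def_ext (fun x env => iterb (c x env) (fun _ v => v %/ a x env) (b x env) (b x env))).
  move=> x env; rewrite /iterb; set m := a x env; set n := b x env.
  have h p : iter p (fun v => v %/ m) n <= n.
    by elim: p => //= p IH; apply: leq_trans (leq_div _ _) IH.
  by elim: (c x env) => //= p ->; have /= := h p.+1; lia.
apply: (@def_iter c b b hc hb hb (fun x env _ v => v %/ a x env)).
apply: def_div; def_tac.
Qed.

Ltac def_arith := match goal with
  | |- definable (fun x env => (@?a x env) %/ (@?b x env)) => apply: (@def_div a b)
  | |- definable (fun x env => (@?a x env) %% (@?b x env)) => apply: (@def_mod a b)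
  | |- definable (fun x env => (@?a x env) ^ ?c) => apply: (@def_exp a c)
  | |- definable (fun x env => digit (@?a x env) (@?b x env) (@?c x env)) => apply: (@def_digit a b c)
  end.

Ltac def_user ::= def_arith.

(** * The decision procedure *)

Section Tokens.

Variable x : seq bool.

(* An encoded instance is a sequence of unary numbers, of which [token i] is the [i]-th one;
   [token 0] is the number of propositions and [token 1] the number of actions. *)
Definition token (i : nat) :=
  countb (size x) (fun p => (bit_code (onth x p) == 2) &&
    (countb p (fun q => bit_code (onth x q) == 1) == i)).

Definition skip_list (p : nat) := p.+1 + token p.

Definition pos_action (a : nat) :=
  iterb a (fun _ p => skip_list (skip_list (skip_list p))) 2 (size x).

(** A method consists of the task name, the list of labels, and the order, whose length is followed
    by two tokens per pair. *)
Definition skip_method (p : nat) :=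
  (skip_list p.+1).+1 + 2 * token (skip_list p.+1).

(** The position after the last action holds the number of compound tasks, the one after it the
    number of methods. *)
Definition pos_labels :=
  iterb (token (pos_action (token 1)).+1) (fun _ p => skip_method p)
    (pos_action (token 1)).+2 (size x).

(* The successor skips the single token that encodes an empty order. *)
Definition pos_init := (skip_list pos_labels).+1.
Definition pos_goal := skip_list pos_init.

Definition count_list (p v : nat) := countb (token p) (fun i => token (p.+1 + i) == v).
Definition mem_list (p v : nat) := 0 < count_list p v.

Definition mem_pre (a f : nat) := mem_list (pos_action a) f.
Definition mem_del (a f : nat) := mem_list (skip_list (pos_action a)) f.
Definition mem_add (a f : nat) := mem_list (skip_list (skip_list (pos_action a))) f.

Variable k : nat.

(* The base [(token 1).+1] digits of [R] describe [k] words of [k] actions each; the digit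
   [token 1], which is not an action, stands for no action. *)
Definition word_letter (R i j : nat) := digit (token 1).+1 R (i * k + j).

(** A single proposition is followed along the word, with a bit as accumulator, because the code of
    a whole set of propositions would be exponentially large. *)
Definition mem_state (R i f : nat) : nat :=
  iterb k (fun j acc =>
      (word_letter R i j == token 1) && (acc == 1) ||
      (word_letter R i j != token 1) &&
        ((acc == 1) && ~~ mem_del (word_letter R i j) f || mem_add (word_letter R i j) f))
    (mem_list pos_init f) 1.

Definition enabled (R i a : nat) := allb (token 0) (fun f => mem_pre a f ==> (mem_state R i f == 1)).

Definition leads_to (R i a i' : nat) :=
  allb (token 0) (fun f =>
    mem_state R i' f == ((mem_state R i f == 1) && ~~ mem_del a f || mem_add a f)).

(** The first conjunct forces word 0 to be idle throughout, so that index 0 stands for the initial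
    state. *)
Definition closed_family (R : nat) :=
  allb k (fun j => word_letter R 0 j == token 1) &&
  allb k (fun i => allb (token 1) (fun a =>
    enabled R i a ==> exb k (fun i' => leads_to R i a i'))).

(** Counting the [m] with no successor index up to [m] gives the least successor index, and [k] if
    the action is not enabled. Taking the least one yields a function even when the family repeats a
    state. *)
Definition next_state (R i a : nat) :=
  countb k (fun m => ~~ (enabled R i a && exb m.+1 (fun i' => leads_to R i a i'))).

(* Digit [i] of a type in base [k.+1] is the state reached from state [i]; the digit [k] means
   that the action is not executable in state [i]. *)
Definition has_type (R t a : nat) := allb k (fun i => digit k.+1 t i == next_state R i a).

Definition types := k.+1 ^ k.

Definition flow (N i t : nat) := digit (token pos_labels).+1 N (i * types + t).

Definition flow_edges (N : nat) :=
  allb k (fun i => allb types (fun t => (0 < flow N i t) ==> (digit k.+1 t i < k))).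

(** The index [e] is the guessed end of the walk that starts in 0. *)
Definition flow_balanced (N : nat) :=
  exb k (fun e => allb k (fun v =>
    sumb types (fun t => flow N v t) + (v == e) ==
    sumb k (fun i => sumb types (fun t => (digit k.+1 t i == v) * flow N i t)) + (v == 0))).

(** Reachability along the support is expressed by quantifying over all subsets, coded by their
    binary digits; there are only [2 ^ k] of them, a constant number. *)
Definition flow_connected (N : nat) :=
  allb (2 ^ k) (fun Z =>
    (digit 2 Z 0 == 1) ==>
    allb k (fun i => allb types (fun t =>
      (0 < flow N i t) && (digit 2 Z i == 1) ==> (digit 2 Z (digit k.+1 t i) == 1))) ==>
    allb k (fun i => allb types (fun t => (0 < flow N i t) ==> (digit 2 Z i == 1)))).

Definition flow_bounds (R N : nat) :=
  allb types (fun t =>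
    (countb (token pos_goal) (fun g => has_type R t (token (pos_goal.+1 + g)))
       <= sumb k (fun i => flow N i t)) &&
    (sumb k (fun i => flow N i t)
       <= countb (token pos_labels) (fun l => has_type R t (token (pos_labels.+1 + l))))).

(** Bounds per type alone would let another action of the same type stand in for a missing action of
    the goal. *)
Definition goal_available :=
  allb (token 1) (fun a => count_list pos_goal a <= count_list pos_labels a).

Definition decider :=
  goal_available &&
  exb ((token 1).+1 ^ (k * k)) (fun R => closed_family R &&
    exb ((token pos_labels).+1 ^ (k * types)) (fun N =>
      flow_edges N && flow_balanced N && flow_connected N && flow_bounds R N)).

End Tokens.

(** * Definability of the decision procedure *)

Section Definability.

Variable k : nat.

Lemma def_token a : definable a -> definable (fun x env => token x (a x env)).
Proof. move=> ha; rewrite /token; def_tac. Qed.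

Ltac def_user ::= first [def_arith | match goal with
  | |- definable (fun x env => token x (@?a x env)) => apply: (@def_token a)
  end].

Lemma def_pos_labels : definable (fun x env => pos_labels x).
Proof. rewrite /pos_labels /skip_method /pos_action /skip_list; def_tac. Qed.

Lemma def_mem_state a b c : definable a -> definable b -> definable c ->
  definable (fun x env => mem_state x k (a x env) (b x env) (c x env)).
Proof.
move=> ha hb hc; rewrite /mem_state /mem_del /mem_add /mem_list /count_list /word_letter.
rewrite /pos_init /pos_labels /skip_method /pos_action /skip_list; def_tac.
Qed.

Ltac def_states := first [def_arith | exact: def_pos_labels | match goal with
  | |- definable (fun x env => token x (@?a x env)) => apply: (@def_token a)
  | |- definable (fun x env => mem_state x k (@?a x env) (@?b x env) (@?c x env)) =>
      apply: (@def_mem_state a b c)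
  end].

Ltac def_user ::= def_states.

Lemma def_closed_family a :
  definable a -> definable (fun x env => closed_family x k (a x env)).
Proof.
move=> ha; rewrite /closed_family /enabled /leads_to /mem_pre /mem_del /mem_add /mem_list.
rewrite /count_list /word_letter /pos_action /skip_list; def_tac.
Qed.

Lemma def_has_type a b c : definable a -> definable b -> definable c ->
  definable (fun x env => has_type x k (a x env) (b x env) (c x env)).
Proof.
move=> ha hb hc; rewrite /has_type /next_state /enabled /leads_to.
rewrite /mem_pre /mem_del /mem_add /mem_list /count_list /pos_action /skip_list; def_tac.
Qed.

Ltac def_user ::= first [def_states | match goal with
  | |- definable (fun x env => nat_of_bool (closed_family x k (@?a x env))) =>
      apply: (@def_closed_family a)
  | |- definable (fun x env => nat_of_bool (has_type x k (@?a x env) (@?b x env) (@?c x env))) =>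
      apply: (@def_has_type a b c)
  end].

Lemma def_decider : definable (fun x env => decider x k).
Proof.
rewrite /decider /goal_available /flow_edges /flow_balanced /flow_connected /flow_bounds /flow.
rewrite /count_list /pos_goal /pos_init /skip_list; def_tac.
Qed.

End Definability.

(** * Eulerian walks in directed multigraphs *)

Section Walks.

Variables (V E : eqType) (src tgt : E -> V).

Fixpoint walk (s : V) (w : seq E) : bool :=
  if w is e :: w' then (src e == s) && walk (tgt e) w' else true.

Definition walk_end (s : V) (w : seq E) : V := last s (map tgt w).

Lemma walk_cat s w1 w2 : walk s (w1 ++ w2) = walk s w1 && walk (walk_end s w1) w2.
Proof. by elim: w1 s => //= e w IH s; rewrite IH andbA. Qed.

Lemma walk_end_cat s w1 w2 : walk_end s (w1 ++ w2) = walk_end (walk_end s w1) w2.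
Proof. by rewrite /walk_end map_cat last_cat. Qed.

Lemma walk_balance s w v : walk s w ->
  count (fun e => src e == v) w + (v == walk_end s w) =
  count (fun e => tgt e == v) w + (v == s).
Proof.
elim: w s => [|e w IH] s //= /andP[/eqP <- /IH] h.
rewrite /walk_end /= -/(walk_end (tgt e) w) -addnA h (eq_sym v (tgt e)) (eq_sym (src e)); lia.
Qed.

End Walks.

Section Euler.

Variables (V : eqType) (E : finType) (src tgt : E -> V).
Implicit Types (x : E -> nat) (w : seq E) (s t : V).

Definition balanced x s t := forall v,
  \sum_(e | src e == v) x e + (v == t) = \sum_(e | tgt e == v) x e + (v == s).

Lemma sum_count_mem (P : pred E) w : \sum_(e | P e) count_mem e w = count P w.
Proof.
elim: w => [|a w IH] /=; first by rewrite big1.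
rewrite big_split /= IH; congr (_ + _); case: (boolP (P a)) => ha.
  by rewrite (bigD1 a) //= eqxx big1 // => i /andP[_ /negbTE]; rewrite eq_sym => ->.
by rewrite big1 // => i hi; case: eqP ha hi => // ->; case: (P i).
Qed.

Lemma walk_until_stuck x s t : balanced x s t -> exists w,
  [/\ walk src tgt s w, walk_end tgt s w = t, forall e, count_mem e w <= x e &
      forall e, src e = t -> count_mem e w = x e].
Proof.
have [n] := ubnP (\sum_e x e); elim: n => // n IH in x s * => hn hb.
have [/existsP[e /andP[/eqP hs he]]|] := boolP [exists e, (src e == s) && (0 < x e)].
  pose x' e' := x e' - (e' == e).
  have hx (P : pred E) : \sum_(e' | P e') x e' = \sum_(e' | P e') x' e' + P e.
    have -> : nat_of_bool (P e) = \sum_(e' | P e') (e' == e).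
      have /= := sum_count_mem P [:: e]; rewrite addn0 => <-.
      by apply: eq_bigr => e' _; rewrite addn0 eq_sym.
    rewrite -big_split /=; apply: eq_bigr => e' _.
    by rewrite /x' subnK //; case: eqP => // ->.
  have [||w [w1 w2 w3 w4]] := IH x' (tgt e).
  - by move: hn; rewrite (hx predT) /= addn1.
  - move=> v; have := hb v; rewrite !hx -hs (eq_sym v (tgt e)) (eq_sym v (src e)); lia.
  exists (e :: w); split=> //=.
  - by rewrite hs eqxx.
  - move=> e'; have := w3 e'; rewrite /x' (eq_sym e'); case: eqP => [<-|_] /=; lia.
  - move=> e' /w4; rewrite /x' (eq_sym e'); case: eqP => [<-|_] /=; lia.
rewrite negb_exists => /forallP h0.
have hz e : src e = s -> x e = 0 by move=> hs; have := h0 e; rewrite hs eqxx /= -eqn0Ngt => /eqP.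
have est : s = t.
  have := hb s; rewrite eqxx big1; last by move=> e' /eqP /hz.
  by case: (s =P t) => // _; rewrite addn1.
by exists [::]; split=> // e he; rewrite hz // he.
Qed.

Lemma walk_split s w u : u \in s :: map tgt w ->
  exists w1 w2, w = w1 ++ w2 /\ walk_end tgt s w1 = u.
Proof.
elim: w s => [|e w IH] s; first by rewrite mem_seq1 => /eqP ->; exists [::], [::].
rewrite inE => /orP[/eqP ->|/IH[w1 [w2 [-> h]]]]; first by exists [::], (e :: w).
by exists (e :: w1), w2.
Qed.

(* A longest walk visiting a vertex with an unused outgoing arc can be extended by a closed
   walk; otherwise the visited vertices are closed under the arcs of positive multiplicity. *)
Lemma euler_walk x s t : balanced x s t ->
  (forall Z : pred V, Z s -> (forall e, 0 < x e -> Z (src e) -> Z (tgt e)) ->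
     forall e, 0 < x e -> Z (src e)) ->
  exists w, [/\ walk src tgt s w, walk_end tgt s w = t & forall e, count_mem e w = x e].
Proof.
move=> hb hconn.
suff H w : walk src tgt s w -> walk_end tgt s w = t -> (forall e, count_mem e w <= x e) ->
    exists w, [/\ walk src tgt s w, walk_end tgt s w = t & forall e, count_mem e w = x e].
  by have [w [h1 h2 h3 _]] := walk_until_stuck hb; apply: (H w).
have [n] := ubnP (\sum_e (x e - count_mem e w)); elim: n => // n IH in w * => hn hw hend hle.
pose Z := [pred v | v \in s :: map tgt w].
have [/existsP[e /andP[he hz]]|] := boolP [exists e, (count_mem e w < x e) && Z (src e)].
  have [|c [c1 c2 c3 c4]] := @walk_until_stuck (fun e => x e - count_mem e w) (src e) (src e).
    move=> v; rewrite !sumnB // !sum_count_mem.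
    have h1 : count (fun e => src e == v) w <= \sum_(e | src e == v) x e.
      by rewrite -sum_count_mem leq_sum.
    have h2 : count (fun e => tgt e == v) w <= \sum_(e | tgt e == v) x e.
      by rewrite -sum_count_mem leq_sum.
    move: (hb v) (walk_balance v hw) h1 h2; rewrite hend /=.
    set a := count _ w; set b := count _ w; set c := bigop _ _ _; set d := bigop _ _ _; lia.
  have [w1 [w2 [ew ew1]]] := walk_split hz.
  have cnt e' : count_mem e' (w1 ++ c ++ w2) = count_mem e' w + count_mem e' c.
    by rewrite ew !count_cat; lia.
  move: hw hend; rewrite ew walk_cat walk_end_cat ew1 => /andP[hw1 hw2] hend.
  apply: (IH (w1 ++ c ++ w2)).
  - have hlt : \sum_e (x e - count_mem e (w1 ++ c ++ w2)) < \sum_e (x e - count_mem e w).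
      have c0 : 0 < count_mem e c by rewrite c4 // subn_gt0.
      rewrite (bigD1 e) //= [in X in _ < X](bigD1 e) //= -addSn; apply: leq_add.
        rewrite cnt; move: (c3 e) (hle e) c0 => /=.
        by set a := count_mem e w; set b := count_mem e c; lia.
      by apply: leq_sum => e' _; rewrite leq_sub2l // cnt leq_addr.
    by apply: leq_trans hlt _; rewrite -ltnS.
  - by rewrite !walk_cat hw1 ew1 c1 c2.
  - by rewrite !walk_end_cat ew1 c2.
  - move=> e'; rewrite cnt; move: (c3 e') (hle e') => /=.
    by set a := count_mem e' w; set b := count_mem e' c; lia.
rewrite negb_exists => /forallP h0; exists w; split=> // e; apply/eqP; rewrite eqn_leq hle.
rewrite leqNgt; apply/negP => he.
have := h0 e; rewrite he /= => /negP; apply; apply: hconn (leq_ltn_trans (leq0n _) he).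
  exact: mem_head.
move=> e' he' hz'; have := h0 e'; rewrite negb_and -leqNgt => /orP[hge|/negP[] //].
have : e' \in w by rewrite -has_pred1 has_count; lia.
by move=> hin; change (tgt e' \in s :: map tgt w); rewrite in_cons map_f ?orbT.
Qed.

End Euler.

(** [G] contains the required elements and [O] the optional ones. Going through [ts], a required
    element of the demanded type is taken first, an optional one only when none is left; the first
    inequality ensures that [G] gets exhausted, the second that the supply suffices. *)
Lemma choose_labels (A : eqType) (B : eqType) (typ : A -> B) (ts : seq B) (G O : seq A) :
  (forall t, count (fun a => typ a == t) G <= count_mem t ts) ->
  (forall t, count_mem t ts <= count (fun a => typ a == t) (G ++ O)) ->
  exists l r, [/\ perm_eq (G ++ O) (l ++ r), map typ l = ts &
    forall a, count_mem a G <= count_mem a l].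
Proof.
elim: ts G O => [|t ts IH] G O h1 h2.
  exists [::], (G ++ O); split=> // a.
  case: G h1 {h2} => // b G h1; by have := h1 (typ b); rewrite /= eqxx.
have [/hasP[a ha /eqP ta]|hG] := boolP (has (fun a => typ a == t) G).
  have pG := perm_to_rem ha.
  have cG u : count (fun a => typ a == u) G = (t == u) + count (fun a => typ a == u) (rem a G).
    by rewrite (permP pG) /= ta.
  have [||l [r [p1 p2 p3]]] := IH (rem a G) O.
  - by move=> u; have := h1 u; rewrite cG /=; lia.
  - by move=> u; have := h2 u; rewrite !count_cat cG /=; lia.
  exists (a :: l), r; split; last first.
  - by move=> b; rewrite (permP pG) /= leq_add2l.
  - by rewrite /= p2 ta.
  - by rewrite (perm_trans (perm_cat pG (perm_refl O))) //= perm_cons.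
have zG : count (fun a => typ a == t) G = 0 by apply/eqP; rewrite -leqn0 leqNgt -has_count.
have /hasP[a ha /eqP ta] : has (fun a => typ a == t) O.
  by have := h2 t; rewrite has_count count_cat zG /= eqxx; lia.
have pO := perm_to_rem ha.
have cO u : count (fun a => typ a == u) O = (t == u) + count (fun a => typ a == u) (rem a O).
  by rewrite (permP pO) /= ta.
have [||l [r [p1 p2 p3]]] := IH G (rem a O).
- by move=> u; have := h1 u; rewrite /=; case: eqP => [<-|]; rewrite ?zG; lia.
- by move=> u; have := h2 u; rewrite !count_cat cO /=; lia.
exists (a :: l), r; split.
- rewrite (perm_trans (perm_cat (perm_refl G) pO)) //.
  by rewrite perm_catC /= perm_cons perm_catC (perm_trans _ p1) // perm_catC.
- by rewrite /= p2 ta.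
- by move=> b; apply: leq_trans (p3 b) _; rewrite /= leq_addl.
Qed.

(** * Runs of types and their flows *)

Section Flows.

Variables (k T : nat) (tg : nat -> nat -> nat).
Hypothesis k_gt0 : 0 < k.

Fixpoint typed_run (i : nat) (ts : seq nat) : bool :=
  if ts is t :: ts' then (tg t i < k) && typed_run (tg t i) ts' else true.

Definition valid_flow (X : nat -> nat -> nat) : Prop :=
  [/\ forall i t, i < k -> t < T -> 0 < X i t -> tg t i < k,
      exists2 e, e < k & forall v, v < k ->
        \sum_(t < T) X v t + (v == e) =
        \sum_(i < k) \sum_(t < T) (tg t i == v) * X i t + (v == 0) &
      forall Z : pred nat, Z 0 ->
        (forall i t, i < k -> t < T -> 0 < X i t -> Z i -> Z (tg t i)) ->
        forall i t, i < k -> t < T -> 0 < X i t -> Z i].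

Fixpoint trace (i : nat) (ts : seq nat) : seq (nat * nat) :=
  if ts is t :: ts' then (i, t) :: trace (tg t i) ts' else [::].

Let arc_src (e : nat * nat) := e.1.
Let arc_tgt (e : nat * nat) := tg e.2 e.1.

Lemma walk_trace i ts : walk arc_src arc_tgt i (trace i ts).
Proof. by elim: ts i => //= t ts IH i; rewrite IH eqxx. Qed.

Lemma trace_in_range i ts : i < k -> typed_run i ts -> all (fun t => t < T) ts ->
  all (fun e : nat * nat => (e.1 < k) && (e.2 < T)) (trace i ts).
Proof.
by elim: ts i => //= t ts IH i hi /andP[h1 h2] /andP[h3 h4]; rewrite hi h3 /= IH.
Qed.

Lemma trace_end_lt i ts : i < k -> typed_run i ts -> walk_end arc_tgt i (trace i ts) < k.
Proof. by elim: ts i => //= t ts IH i hi /andP[h1 h2]; apply: (IH (tg t i)). Qed.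

Lemma sum_trace (P : nat -> nat -> bool) (w : seq (nat * nat)) :
  all (fun e : nat * nat => (e.1 < k) && (e.2 < T)) w ->
  \sum_(i < k) \sum_(t < T) P i t * count_mem (i : nat, t : nat) w =
  count (fun e => P e.1 e.2) w.
Proof.
elim: w => [|[i t] w IH] /=.
  by move=> _; apply: big1 => i _; apply: big1 => t _; rewrite muln0.
move=> /andP[/andP[hi ht] /IH <-].
transitivity (\sum_(j < k) (\sum_(u < T) P j u * ((i, t) == (j : nat, u : nat)) +
   \sum_(u < T) P j u * count_mem (j : nat, u : nat) w)).
  by apply: eq_bigr => j _; rewrite -big_split /=; apply: eq_bigr => u _; rewrite mulnDr.
rewrite big_split /=; congr (_ + _).
rewrite (bigD1 (Ordinal hi)) //= (bigD1 (Ordinal ht)) //= eqxx muln1.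
rewrite big1 ?addn0 => [|u hu]; last first.
  rewrite xpair_eqE eqxx /=; case: (t =P u) => [e|_]; last by rewrite muln0.
  by move: hu; rewrite -val_eqE /= e eqxx.
rewrite big1 ?addn0 // => j hj; apply: big1 => u _.
rewrite xpair_eqE /=; case: (i =P j) => [e|_]; last by rewrite muln0.
by move: hj; rewrite -val_eqE /= e eqxx.
Qed.

(** The flow counts the occurrences of each arc in the trace. Its balance is that of a walk, and a
    closed set containing 0 contains all vertices along the trace. *)
Lemma flow_of_run ts : all (fun t => t < T) ts -> typed_run 0 ts -> exists X,
  [/\ valid_flow X, forall i t, X i t <= size ts &
      forall t, t < T -> \sum_(i < k) X i t = count_mem t ts].
Proof.
move=> hT hr; set w := trace 0 ts.
have sw : size w = size ts by rewrite /w; elim: (ts) 0 => //= t us IH i; rewrite IH.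
have mw : map snd w = ts by rewrite /w; elim: (ts) 0 => //= t us IH i; rewrite IH.
have rw := trace_in_range k_gt0 hr hT.
have inw i t : 0 < count_mem (i, t) w -> (i, t) \in w by rewrite -has_pred1 has_count.
exists (fun i t => count_mem (i, t) w); split.
- split.
  + move=> i t hi ht /inw; rewrite /w; elim: (ts) 0 hr => //= u us IH j /andP[h1 h2].
    by rewrite inE => /orP[/eqP[-> ->] //|]; apply: IH.
  + exists (walk_end arc_tgt 0 w); first exact: trace_end_lt.
    move=> v hv.
    have -> : \sum_(t < T) count_mem (v, t : nat) w = count (fun e => arc_src e == v) w.
      rewrite -(sum_trace (fun i t => i == v)) //.
      rewrite (bigD1 (Ordinal hv)) //= [X in _ = _ + X]big1 ?addn0.
        by apply: eq_bigr => t _; rewrite eqxx mul1n.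
      by move=> i; rewrite -val_eqE /= => /negbTE ->; apply: big1 => t _; rewrite mul0n.
    rewrite (sum_trace (fun i t => tg t i == v)) //.
    exact: (walk_balance v (walk_trace 0 ts)).
  + move=> Z Z0 hZ i t hi ht hc; have := inw _ _ hc; move=> {hi ht hc}.
    have H u us j : u \in trace j us -> typed_run j us -> Z j -> 
      (forall e : nat * nat, e \in trace j us -> Z e.1 -> Z (tg e.2 e.1)) -> Z u.1.
      elim: us j => //= v us IH j; rewrite inE => /orP[/eqP-> //|hu] /andP[_ h2] Zj hcl.
      apply: (IH (tg v j)) => //; first by apply: (hcl (j, v)) => //; rewrite mem_head.
      by move=> e he; apply: hcl; rewrite inE he orbT.
    move=> hin; apply: (H (i, t) ts 0) => // -[j u] hju /=; have /andP[h1 h2] := allP rw _ hju.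
    by apply: hZ => //; rewrite -has_count has_pred1.
- by move=> i t; rewrite -sw count_size.
- move=> t ht; rewrite -{1}mw count_map.
  rewrite -(sum_trace (fun i u => u == t)) //; apply: eq_bigr => i _.
  rewrite (bigD1 (Ordinal ht)) //= eqxx mul1n big1 ?addn0 // => u.
  by rewrite -val_eqE /= => /negbTE ->; rewrite mul0n.
Qed.

(** Euler's theorem for the multigraph with an arc for each pair of an index and a type, taken with
    multiplicity [X]. *)
Lemma run_of_flow X : valid_flow X -> exists ts,
  [/\ all (fun t => t < T) ts, typed_run 0 ts &
      forall t, t < T -> \sum_(i < k) X i t = count_mem t ts].
Proof.
move=> [h1 [e0 he0 h2] h3].
pose src (e : 'I_k * 'I_T) : nat := e.1.
pose tgt (e : 'I_k * 'I_T) : nat := tg e.2 e.1.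
pose x (e : 'I_k * 'I_T) := X e.1 e.2.
have sumx (P : nat -> nat -> bool) :
    \sum_(e : 'I_k * 'I_T | P e.1 e.2) x e = \sum_(i < k) \sum_(t < T) P i t * X i t.
  rewrite big_mkcond pair_big; apply: eq_bigr => -[i t] _ /=.
  by rewrite /x /=; case: (P i t); rewrite ?mul1n ?mul0n.
have hb : balanced src tgt x 0 e0.
  move=> v; rewrite (sumx (fun i _ => i == v)) (sumx (fun i t => tg t i == v)).
  case: (ltnP v k) => hv.
    rewrite -h2 // (bigD1 (Ordinal hv)) //= [X in _ + X + _]big1 ?addn0.
      by congr (_ + _); apply: eq_bigr => t _; rewrite eqxx mul1n.
    by move=> i; rewrite -val_eqE /= => /negbTE ->; apply: big1 => t _; rewrite mul0n.
  (* At a vertex outside the family both sums vanish: no arc starts there, and an arc of positive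
     multiplicity ends inside. *)
  rewrite !big1 => [||i _]; first by case: eqP; case: eqP; lia.
    move=> i _; apply: big1 => t _; case: eqP => // e; rewrite mul1n; apply/eqP.
    by rewrite -leqn0 leqNgt; apply/negP => /(h1 _ _ (ltn_ord i) (ltn_ord t)); lia.
  by apply: big1 => t _; case: eqP => // e; have := ltn_ord i; lia.
have [|w [w1 w2 w3]] := euler_walk hb.
  move=> Z Z0 hZ [i t] hx; apply: (h3 Z Z0 _ i t (ltn_ord i) (ltn_ord t) hx).
  by move=> j u hj hu hX; apply: (hZ (Ordinal hj, Ordinal hu)).
exists (map (fun e : 'I_k * 'I_T => e.2 : nat) w); split.
- by apply/allP => _ /mapP[e _ ->].
- have : all (fun e => tgt e < k) w.
    apply/allP => e he; apply: h1 => //; rewrite -[X _ _]/(x e) -w3.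
    by rewrite -has_count has_pred1.
  elim: (w) {w2 w3 hb} 0 w1 => //= e u IH s /andP[/eqP <- hw] /andP[-> ha].
  exact: IH.
- move=> t ht; rewrite count_map -(sum_count_mem (preim _ _)).
  transitivity (\sum_(e : 'I_k * 'I_T | e.2 == t :> nat) x e); last by apply: eq_bigr => e _; rewrite w3.
  rewrite (sumx (fun _ u => u == t)); apply: eq_bigr => i _.
  rewrite (bigD1 (Ordinal ht)) //= eqxx mul1n big1 ?addn0 // => u.
  by rewrite -val_eqE /= => /negbTE ->; rewrite mul0n.
Qed.

(** A run fixes only types, and [choose_labels] turns it back into labels. The bound of [X] by
    [size lab] is what makes the flow codable with digits of that size. *)
Lemma run_iff_flow (typ : nat -> nat) (lab goal : seq nat) : (forall a, typ a < T) ->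
  (exists l r, [/\ perm_eq lab (l ++ r), typed_run 0 (map typ l) &
     forall a, count_mem a goal <= count_mem a l]) <->
  ((forall a, count_mem a goal <= count_mem a lab) /\
   exists X, [/\ valid_flow X, forall i t, X i t <= size lab &
     forall t, t < T -> count (fun a => typ a == t) goal <= \sum_(i < k) X i t
                        <= count (fun a => typ a == t) lab]).
Proof.
move=> hT; split.
  move=> [l [r [p1 p2 p3]]]; split.
    by move=> a; rewrite (permP p1) count_cat; apply: leq_trans (p3 a) (leq_addr _ _).
  have [|X [x1 x2 x3]] := flow_of_run _ p2; first by apply/allP => _ /mapP[a _ ->].
  exists X; split=> //.
    by move=> i t; rewrite (perm_size p1) size_cat; apply: leq_trans (x2 i t) _; rewrite size_map leq_addr.
  move=> t ht; rewrite x3 // count_map (permP p1) count_cat leq_addr andbT.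
  have /count_subseqP[s sl ps] := p3.
  by rewrite (permP ps); apply: leq_count_subseq.
move=> [hg [X [x1 x2 x3]]].
have [ts [t1 t2 t3]] := run_of_flow x1.
have /count_subseqP[s sl ps] := hg; have [O pO] := perm_to_subseq sl.
have pg : perm_eq lab (goal ++ O) by rewrite (perm_trans pO) // perm_cat2r perm_sym.
have out u : T <= u -> count_mem u ts = 0.
  move=> hu; apply/eqP; rewrite -leqn0 leqNgt -has_count has_pred1; apply/negP => /(allP t1).
  by lia.
have z u s' : T <= u -> count (fun a => typ a == u) s' = 0.
  move=> hu; apply/eqP; rewrite -leqn0 leqNgt -has_count; apply/hasPn => a _.
  by have := hT a; lia.
have [u|u|l [r [p1 p2 p3]]] := @choose_labels _ _ typ ts goal O.
- by case: (ltnP u T) => hu; [rewrite -t3 //; case/andP: (x3 u hu) | rewrite out ?z].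
- case: (ltnP u T) => hu; last by rewrite out ?z.
  by rewrite -(permP pg) -t3 //; case/andP: (x3 u hu).
by exists l, r; split=> //; [apply: perm_trans p1 | rewrite p2].
Qed.

End Flows.

(** * Reading an encoded instance *)

Lemma countbS n (P : nat -> bool) : countb n.+1 P = P 0 + countb n (fun i => P i.+1).
Proof. by rewrite /countb /= -[1]addn0 iotaDl count_map. Qed.

Lemma eq_countb n (P Q : nat -> bool) :
  (forall i, i < n -> P i = Q i) -> countb n P = countb n Q.
Proof. by move=> h; apply: eq_in_count => i; rewrite mem_iota => /h. Qed.

(** A leading true bit lengthens the first number by one; a leading false bit is a complete number 0
    and shifts the others. *)
Lemma token_cons b x i :
  token (b :: x) i = if b then (i == 0) + token x i else (0 < i) * token x i.-1.
Proof.
rewrite /token /= countbS /=.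
case: b => /=.
  congr (_ + _); first by rewrite /countb /= eq_sym.
  by apply: eq_countb => p _; rewrite countbS.
rewrite add0n; case: i => [|i] /=.
  rewrite mul0n (@eq_countb _ _ xpred0); first by rewrite /countb count_pred0.
  by move=> p _; rewrite countbS andbF.
by rewrite mul1n; apply: eq_countb => p _; rewrite countbS.
Qed.

Lemma token_flatten ts i : token (flatten (map enc_nat ts)) i = nth 0 ts i.
Proof.
elim: ts i => [|t ts IH] i /=; first by rewrite /token /countb nth_nil.
rewrite /enc_nat -catA; elim: t => [|t IHt] /=.
  by rewrite token_cons IH; case: i => [|i]; rewrite ?mul0n ?mul1n.
by rewrite token_cons IHt; case: i {IHt} => //= i.
Qed.

Definition toks_list (s : seq nat) := size s :: s.
Definition toks_order (o : seq (nat * nat)) := size o :: flatten [seq [:: p.1; p.2] | p <- o].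
Definition toks_action (a : action_data) := toks_list a.1.1 ++ toks_list a.1.2 ++ toks_list a.2.
Definition toks_method (m : nat * tnet_data) := m.1 :: toks_list m.2.1 ++ toks_order m.2.2.

Definition toks (I : instance) :=
  hF I :: size (acts I) :: flatten (map toks_action (acts I)) ++
  hC I :: size (methods I) :: flatten (map toks_method (methods I)) ++
  toks_list (tn_labels I) ++ toks_order (tn_order I) ++
  toks_list (init_state I) ++ toks_list (goal_ms I).

Local Notation enc_toks ts := (flatten (map enc_nat ts)).

Lemma enc_toks_cat ts us : enc_toks (ts ++ us) = enc_toks ts ++ enc_toks us.
Proof. by rewrite map_cat flatten_cat. Qed.

Lemma enc_list_toks (A : Type) (f : A -> seq bool) (g : A -> seq nat) s :
  (forall a, f a = enc_toks (g a)) -> @enc_list A f s = enc_toks (size s :: flatten (map g s)).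
Proof.
move=> h; rewrite /enc_list /=; congr (_ ++ _).
by elim: s => //= a s IH; rewrite enc_toks_cat IH h.
Qed.

Lemma enc_seqnat_toks s : enc_seqnat s = enc_toks (toks_list s).
Proof.
rewrite /enc_seqnat (@enc_list_toks _ _ (fun n => [:: n])) => [|n]; last by rewrite /= cats0.
by rewrite /toks_list; congr (enc_toks (_ :: _)); elim: s => //= n s ->.
Qed.

Lemma enc_order_toks o : enc_order o = enc_toks (toks_order o).
Proof. by apply: enc_list_toks => -[a b]; rewrite /enc_pair /= cats0. Qed.

Lemma encode_toks I : encode I = enc_toks (toks I).
Proof.
have encN n : enc_nat n = enc_toks [:: n] by rewrite /= cats0.
rewrite /encode (@enc_list_toks _ _ toks_action) => [|a]; last first.
  by rewrite /enc_action !enc_seqnat_toks -!enc_toks_cat.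
rewrite (@enc_list_toks _ _ toks_method) => [|[c [l o]]]; last first.
  by rewrite /enc_pair encN /enc_tnet enc_seqnat_toks enc_order_toks -!enc_toks_cat.
rewrite !enc_seqnat_toks enc_order_toks (encN (hF I)) (encN (hC I)) -!enc_toks_cat.
by rewrite /toks /= -!catA.
Qed.

Section Positions.

Variables (x : seq bool) (ts : seq nat).
Hypothesis xE : x = enc_toks ts.

Lemma size_toks : size ts <= size x.
Proof.
rewrite xE; elim: (ts) => //= t us IH; rewrite size_cat -add1n leq_add //.
by rewrite /enc_nat size_cat addn1.
Qed.

Lemma token_at p v r : drop p ts = v :: r -> token x p = v /\ drop p.+1 ts = r.
Proof.
move=> h; split; first by rewrite xE token_flatten -[p]addn0 -nth_drop h.
by rewrite -add1n -drop_drop h /= drop0.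
Qed.

Lemma skip_at p s r : drop p ts = toks_list s ++ r -> drop (skip_list x p) ts = r.
Proof.
move=> /token_at[h1 h2]; rewrite /skip_list h1 addnC -drop_drop h2.
by rewrite drop_size_cat.
Qed.

Lemma countb_list (P : pred nat) p s r : drop p ts = toks_list s ++ r ->
  countb (token x p) (fun i => P (token x (p.+1 + i))) = count P s.
Proof.
move=> /token_at[-> h].
rewrite (@eq_countb _ _ (fun i => P (nth 0 s i))) => [|i hi].
  by rewrite /countb -[in RHS](mkseq_nth 0 s) /mkseq count_map.
by rewrite xE token_flatten -nth_drop h nth_cat hi.
Qed.

Lemma count_list_at p s r v : drop p ts = toks_list s ++ r -> count_list x p v = count_mem v s.
Proof. exact: (@countb_list (pred1 v)). Qed.

Lemma mem_list_at p s r v : drop p ts = toks_list s ++ r -> mem_list x p v = (v \in s).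
Proof. by move=> h; rewrite /mem_list (count_list_at _ h) -has_count has_pred1. Qed.

(** Since [r] is nonempty, each position reached lies inside the token list, which is no longer than
    [x]; hence truncation at [size x] never takes effect. *)
Lemma iterb_at (A : Type) (f : A -> seq nat) (step : nat -> nat) (xs : seq A) r p a :
  (forall q b u, drop q ts = f b ++ u -> drop (step q) ts = u) ->
  0 < size r -> drop p ts = flatten (map f xs) ++ r -> a <= size xs ->
  drop (iterb a (fun _ => step) p (size x)) ts = flatten (map f (drop a xs)) ++ r.
Proof.
move=> hstep hr hp; elim: a => [|a IH] ha /=; first by rewrite drop0.
have := IH (ltnW ha); case: xs ha {hp IH} => // b0 xs ha.
rewrite (drop_nth b0 ha) /= -catA => /hstep h.
rewrite /iterb /= -/(iterb _ _ _ _); set q := step _ in h *.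
have hq : q < size x.
  apply: leq_trans size_toks; have := congr1 size h; rewrite size_drop size_cat.
  by lia.
by rewrite (minn_idPl (ltnW hq)).
Qed.

End Positions.

Section InstanceTokens.

Variable I : instance.
Hypothesis no_order : tn_order I = [::].
Let x := encode I.
Let xE : x = enc_toks (toks I) := encode_toks I.

Lemma token0 : token x 0 = hF I.
Proof. by rewrite xE token_flatten. Qed.

Lemma token1 : token x 1 = size (acts I).
Proof. by rewrite xE token_flatten. Qed.

Let after_actions :=
  hC I :: size (methods I) :: flatten (map toks_method (methods I)) ++
  toks_list (tn_labels I) ++ toks_order (tn_order I) ++
  toks_list (init_state I) ++ toks_list (goal_ms I).

Lemma pos_action_at a : a <= size (acts I) ->
  drop (pos_action x a) (toks I) = flatten (map toks_action (drop a (acts I))) ++ after_actions.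
Proof.
move=> ha; apply: (iterb_at xE) => // [q b u|].
  by rewrite /toks_action -!catA => h; do 3 apply: (skip_at xE); exact: h.
by rewrite /toks /= drop0.
Qed.

Lemma pos_action_lists a : a < size (acts I) -> exists r,
  drop (pos_action x a) (toks I) = toks_action (act_of I a) ++ r.
Proof.
move=> ha; have := pos_action_at (ltnW ha); rewrite (drop_nth ([::], [::], [::]) ha) /= -catA.
by eexists; eassumption.
Qed.

Lemma mem_preE a f : a < size (acts I) -> mem_pre x a f = (f \in (act_of I a).1.1).
Proof.
move=> /pos_action_lists[r]; rewrite /toks_action -!catA => h.
exact: (mem_list_at xE _ h).
Qed.

Lemma mem_delE a f : a < size (acts I) -> mem_del x a f = (f \in (act_of I a).1.2).
Proof.
move=> /pos_action_lists[r]; rewrite /toks_action -!catA => /(skip_at xE) h.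
exact: (mem_list_at xE _ h).
Qed.

Lemma mem_addE a f : a < size (acts I) -> mem_add x a f = (f \in (act_of I a).2).
Proof.
move=> /pos_action_lists[r]; rewrite /toks_action -!catA => /(skip_at xE) /(skip_at xE) h.
exact: (mem_list_at xE _ h).
Qed.

Lemma pos_labels_at : drop (pos_labels x) (toks I) =
  toks_list (tn_labels I) ++ toks_order (tn_order I) ++
  toks_list (init_state I) ++ toks_list (goal_ms I).
Proof.
have := pos_action_at (leqnn _); rewrite drop_size /= -token1 => /(token_at xE)[_].
move=> /(token_at xE)[hm h]; rewrite /pos_labels hm.
rewrite (iterb_at xE (f := toks_method) (step := skip_method x) _ _ h) ?drop_size //.
move=> q [c [l o]] u; rewrite /toks_method cat_cons -catA => /(token_at xE)[_ /(skip_at xE) h'].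
have [h1 h2] := token_at xE h'; rewrite /skip_method h1 addnC -drop_drop h2.
rewrite drop_size_cat // mul2n; elim: (o) => //= -[a b] s /= ->; by rewrite doubleS.
Qed.

Lemma pos_init_at :
  drop (pos_init x) (toks I) = toks_list (init_state I) ++ toks_list (goal_ms I).
Proof.
have /(skip_at xE) := pos_labels_at; rewrite no_order => h.
by have [] := token_at xE h.
Qed.

Lemma pos_goal_at : drop (pos_goal x) (toks I) = toks_list (goal_ms I) ++ [::].
Proof. by rewrite cats0; have /(skip_at xE) := pos_init_at. Qed.

Lemma mem_initE f : mem_list x (pos_init x) f = (f \in init_state I).
Proof. exact: (mem_list_at xE _ pos_init_at). Qed.

Lemma count_goalE v : count_list x (pos_goal x) v = count_mem v (goal_ms I).
Proof. exact: (count_list_at xE _ pos_goal_at). Qed.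

Lemma count_labelsE v : count_list x (pos_labels x) v = count_mem v (tn_labels I).
Proof. exact: (count_list_at xE _ pos_labels_at). Qed.

Lemma countb_goalE (P : pred nat) :
  countb (token x (pos_goal x)) (fun g => P (token x ((pos_goal x).+1 + g))) = count P (goal_ms I).
Proof. exact: (countb_list xE _ pos_goal_at). Qed.

Lemma countb_labelsE (P : pred nat) :
  countb (token x (pos_labels x)) (fun l => P (token x ((pos_labels x).+1 + l))) =
  count P (tn_labels I).
Proof. exact: (countb_list xE _ pos_labels_at). Qed.

Lemma token_labelsE : token x (pos_labels x) = size (tn_labels I).
Proof. by have [] := token_at xE pos_labels_at. Qed.

End InstanceTokens.

(** * Correctness of the decision procedure *)

Local Arguments apply_act {I} _ _.
Local Arguments exec_from {I} _ _.

(** * Coding of finite tables by digits *)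

Fixpoint from_digits (b n : nat) (f : nat -> nat) : nat :=
  if n is n'.+1 then f 0 + b * from_digits b n' (fun i => f i.+1) else 0.

Lemma from_digits_lt b n f : (forall i, i < n -> f i < b) -> from_digits b n f < b ^ n.
Proof.
elim: n f => [|n IH] f h //=; rewrite expnS.
by have := h 0 isT; have := IH (fun i => f i.+1) (fun i => h i.+1); nia.
Qed.

Lemma digit_from_digits b n f i : (forall i, i < n -> f i < b) -> i < n ->
  digit b (from_digits b n f) i = f i.
Proof.
elim: n f i => [|n IH] f [|i] //= h hi; have h0 := h 0 isT; rewrite /digit.
  by rewrite /= mulnC addnC modnMDl modn_small.
rewrite iterSr mulnC addnC divnMDl ?divn_small ?addn0 //; last by lia.
by apply: (IH (fun i => f i.+1)) => // j; apply: (h j.+1).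
Qed.

(** Lets the digitwise test [has_type] be read as an equality of types. *)
Lemma digit_inj b n M N : M < b ^ n -> N < b ^ n ->
  (forall i, i < n -> digit b M i = digit b N i) -> M = N.
Proof.
elim: n M N => [|n IH] M N; first by rewrite expn0; lia.
move=> hM hN h; rewrite (divn_eq M b) (divn_eq N b); have /= := h 0 isT; rewrite /digit /= => ->.
have b0 : 0 < b by case: b hM {IH h hN} => //; rewrite exp0n.
congr (_ * _ + _); apply: IH.
- by rewrite ltn_divLR // mulnC -expnS.
- by rewrite ltn_divLR // mulnC -expnS.
- by move=> i hi; have := h i.+1 hi; rewrite /digit !iterSr.
Qed.

Lemma digit_lt b N i : 0 < b -> digit b N i < b.
Proof. exact: ltn_pmod. Qed.

Definition from_table (b m n : nat) (f : nat -> nat -> nat) : nat :=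
  from_digits b (m * n) (fun p => f (p %/ n) (p %% n)).

Lemma from_table_lt b m n f : (forall i j, f i j < b) -> from_table b m n f < b ^ (m * n).
Proof. by move=> h; apply: from_digits_lt. Qed.

Lemma digit_from_table b m n f i j : (forall i j, f i j < b) -> i < m -> j < n ->
  digit b (from_table b m n f) (i * n + j) = f i j.
Proof.
move=> h hi hj; rewrite digit_from_digits //; last by nia.
by rewrite divnMDl ?(leq_ltn_trans _ hj) // divn_small // addn0 modnMDl modn_small.
Qed.

Lemma countb_first k (P : pred nat) :
  countb k (fun m => ~~ exb m.+1 P) = find P (iota 0 k).
Proof.
elim: k => // k IH; rewrite /countb -addn1 iotaD count_cat -/(countb _ _) IH /= addn0 add0n.
rewrite find_cat /exb -[k.+1]addn1 iotaD has_cat /= orbF add0n.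
case: (boolP (has P (iota 0 k))) => h /=; first by rewrite addn0.
by rewrite (hasNfind h) size_iota; case: (P k).
Qed.

(** * Words reaching a closed family of states *)

Section States.

Variable I : instance.
Local Notation nA := (size (acts I)).

Definition effect (s : state I) (a : nat) : state I :=
  (s :\: aset I (act_of I a).1.2) :|: aset I (act_of I a).2.

Lemma apply_actE (s : state I) a :
  apply_act s a = if aset I (act_of I a).1.1 \subset s then Some (effect s a) else None.
Proof. by []. Qed.

Lemma exec_cons (s : state I) a l :
  exec_from s (a :: l) = if apply_act s a is Some s' then exec_from s' l else None.
Proof. by rewrite /exec_from /=; case: (apply_act s a) => //; elim: l. Qed.

Lemma exec_rcons (s : state I) l a :
  exec_from s (rcons l a) = obind (fun s' => apply_act s' a) (exec_from s l).
Proof. by rewrite /exec_from foldl_rcons. Qed.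

Let word_state (w : seq nat) : state I := foldl effect (s0 I) w.

Lemma reachable_words k : at_most_k_states I k -> exists ws : seq (seq nat),
  [/\ 0 < size ws <= k, nth [::] ws 0 = [::],
      all (fun w => (size w < size ws) && all (fun a => a < nA) w) ws &
      forall w a, w \in ws -> a < nA -> aset I (act_of I a).1.1 \subset word_state w ->
        effect (word_state w) a \in map word_state ws].
Proof.
move=> hk.
pose good ws := [/\ 0 < size ws, nth [::] ws 0 = [::], uniq (map word_state ws),
  all (fun w => (size w < size ws) && all (fun a => a < nA) w) ws &
  forall w, w \in ws -> exec_from (s0 I) w = Some (word_state w)].
have size_le ws : good ws -> size ws <= k.
  move=> [_ _ hu ha he]; rewrite -(size_map word_state); apply: hk => // _ /mapP[w hw ->].
  by exists w; have /andP[_ h] := allP ha _ hw; rewrite he.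
suff H ws : good ws -> exists ws, good ws /\
      forall w a, w \in ws -> a < nA -> aset I (act_of I a).1.1 \subset word_state w ->
        effect (word_state w) a \in map word_state ws.
  have [|ws [hg hc]] := H [:: [::]].
    by split=> // w; rewrite mem_seq1 => /eqP ->.
  by exists ws; have [hp h0 _ ha _] := hg; split=> //; rewrite hp size_le.
have [d] := ubnP (k - size ws); elim: d => // d IH in ws * => hd hg.
pose bad w a := (aset I (act_of I a).1.1 \subset word_state w) &&
                (effect (word_state w) a \notin map word_state ws).
have [/hasP[w hw /hasP[a]]|hno] := boolP (has (fun w => has (bad w) (iota 0 nA)) ws); last first.
  exists ws; split=> // w a hw ha hs; apply/negPn/negP => hn.
  case/hasP: hno; exists w => //; apply/hasP; exists a; first by rewrite mem_iota.
  by rewrite /bad hs hn.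
rewrite mem_iota add0n => /= ha /andP[hs hn].
have [g0 g1 g2 g3 g4] := hg.
have /andP[w1 w2] := allP g3 _ hw.
have hr : word_state (rcons w a) = effect (word_state w) a by rewrite /word_state foldl_rcons.
have hg' : good (rcons ws (rcons w a)).
  split; rewrite ?size_rcons ?map_rcons //.
  - by rewrite nth_rcons g0.
  - by rewrite rcons_uniq hr hn.
  - rewrite all_rcons size_rcons ltnS w1 all_rcons ha w2 /=.
    by apply: sub_all g3 => v /andP[/leqW -> ->].
  - move=> v; rewrite mem_rcons inE => /orP[/eqP ->|/g4 //].
    by rewrite exec_rcons (g4 _ hw) /= apply_actE hs hr.
apply: (IH _ _ hg'); have := size_le _ hg'; rewrite size_rcons; lia.
Qed.

End States.

(** * Equivalence of the procedure with executability *)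

Section Correctness.

Variables (I : instance) (k : nat).
Hypothesis k_gt0 : 0 < k.
Hypothesis wf : wf_instance I.
Hypothesis prim : primitive_tn I.
Hypothesis no_order : tn_order I = [::].
Let x := encode I.
Local Notation nA := (size (acts I)).

Definition word_step (s : state I) (a : nat) : state I := if a == nA then s else effect s a.

Definition family_state (R i : nat) : state I :=
  foldl word_step (s0 I) (mkseq (word_letter x k R i) k).

Lemma letter_le R i j : word_letter x k R i j <= nA.
Proof. by rewrite -ltnS /word_letter token1 digit_lt. Qed.

Lemma mem_stateE R i (f : 'I_(hF I)) : mem_state x k R i f = (f \in family_state R i).
Proof.
rewrite /mem_state /family_state /iterb mem_initE //.
have {1}-> : (val f \in init_state I) = (f \in s0 I) by rewrite inE.
(* The letters [L] keep their dependence on [k]; only the number of letters read is generalized for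
   the induction. *)
set F := fun _ _ => minn _ _; set L := word_letter x k R i; move: (k) => n.
elim: n => // n IH; rewrite /mkseq -addn1 iotaD map_cat foldl_cat -/(mkseq _ _) addn1 /=.
rewrite IH /F; set s := foldl _ _ _; rewrite -/(L n); set a := L n.
rewrite token1 /word_step; case: eqP => ha /=.
  by rewrite orbF; case: (f \in s).
have la : a < nA by have := letter_le R i n; rewrite -/(L n) -/a; lia.
rewrite mem_delE // mem_addE // !inE -/(effect _ _).
by case: (f \in s); case: (_ \in _); case: (_ \in _).
Qed.

Lemma enabledE R i a : a < nA ->
  enabled x k R i a = (aset I (act_of I a).1.1 \subset family_state R i).
Proof.
move=> ha; apply/allP_b/subsetP => h.
  move=> f; rewrite inE => hf; have := h f; rewrite token0 ltn_ord mem_preE // hf mem_stateE.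
  by move=> /(_ isT); case: (f \in _).
move=> f; rewrite token0 => hf; apply/implyP; rewrite mem_preE // => hp.
by rewrite (mem_stateE R i (Ordinal hf)) (h (Ordinal hf)) // inE.
Qed.

Lemma leads_toE R i a i' : a < nA ->
  leads_to x k R i a i' = (family_state R i' == effect (family_state R i) a).
Proof.
move=> ha; apply/allP_b/eqP => h.
  apply/setP => f; have := h f; rewrite token0 ltn_ord mem_delE // mem_addE // !mem_stateE !inE.
  by move=> /(_ isT); do 4 case: (_ \in _).
move=> f; rewrite token0 => hf; rewrite mem_delE // mem_addE //.
rewrite (mem_stateE R i (Ordinal hf)) (mem_stateE R i' (Ordinal hf)) h !inE.
by case: (Ordinal hf \in _) => /=; do 2 case: (_ \in _).
Qed.

Lemma closed_familyE R : closed_family x k R ->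
  family_state R 0 = s0 I /\
  forall i a, i < k -> a < nA -> aset I (act_of I a).1.1 \subset family_state R i ->
    exists2 i', i' < k & family_state R i' = effect (family_state R i) a.
Proof.
move=> /andP[/allP_b h0 /allP_b h]; split.
  suff H n : n <= k -> foldl word_step (s0 I) (mkseq (word_letter x k R 0) n) = s0 I by apply: H.
  elim: n => // n IH hn.
  rewrite /mkseq -addn1 iotaD map_cat foldl_cat -/(mkseq _ _) (IH (ltnW hn)) /=.
  by have /eqP := h0 _ hn; rewrite /word_step token1 => ->; rewrite eqxx.
move=> i a hi ha hs; have /allP_b := h i hi; rewrite token1 => /(_ a ha).
rewrite enabledE // hs => /exP_b[i' hi']; rewrite leads_toE // => /eqP e.
by exists i'.
Qed.

Lemma exists_closed_family : at_most_k_states I k ->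
  exists2 R, R < (token x 1).+1 ^ (k * k) & closed_family x k R.
Proof.
move=> /reachable_words[ws [/andP[w0 w1] w2 w3 w4]].
have wk i : size (nth [::] ws i) <= k.
  case: (ltnP i (size ws)) => hi; last by rewrite nth_default.
  by have /andP[h _] := all_nthP [::] w3 i hi; lia.
have wA i j : nth nA (nth [::] ws i) j <= nA.
  case: (ltnP j (size (nth [::] ws i))) => hj; last by rewrite nth_default.
  case: (ltnP i (size ws)) => hi; last by rewrite nth_default // in hj.
  have /andP[_ h] := all_nthP [::] w3 i hi; exact: (ltnW (all_nthP nA h j hj)).
(* The default [nA] pads short words with the idle letter; an index beyond the list gets the empty
   word, hence another copy of the initial state. *)
pose f i j := nth nA (nth [::] ws i) j.
have fA i j : f i j < nA.+1 by rewrite ltnS wA.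
set R := from_table nA.+1 k k f.
have hR i j : i < k -> j < k -> word_letter x k R i j = f i j.
  by move=> hi hj; rewrite /word_letter token1 digit_from_table.
have hs i : i < k -> family_state R i = foldl (@effect I) (s0 I) (nth [::] ws i).
  move=> hi; rewrite /family_state.
  have -> : mkseq (word_letter x k R i) k = mkseq (f i) k.
    by apply/eq_in_map => j; rewrite mem_iota add0n => hj; apply: hR.
  set w := nth [::] ws i; have hw : size w <= k := wk i.
  have -> : mkseq (f i) k = w ++ nseq (k - size w) nA.
    apply: (@eq_from_nth _ 0) => [|j]; first by rewrite size_mkseq size_cat size_nseq subnKC.
    rewrite size_mkseq => hj; rewrite nth_mkseq // nth_cat /f -/w.
    case: ltnP => hjw; first exact: set_nth_default.
    by rewrite nth_default // nth_nseq ifT // ltn_sub2r // (leq_ltn_trans hjw).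
  rewrite foldl_cat; set s := foldl _ _ w.
  have -> : s = foldl (@effect I) (s0 I) w.
    have : all (fun a => a < nA) w.
      rewrite /w; case: (ltnP i (size ws)) => hi'; last by rewrite nth_default.
      by have /andP[] := all_nthP [::] w3 i hi'.
    rewrite /s; elim: (w) (s0 I) => //= a v IH u /andP[ha hv].
    by rewrite IH // /word_step; case: eqP ha => // ->; rewrite ltnn.
  elim: (k - size w) => //= n IH; rewrite (_ : word_step _ nA = foldl (@effect I) (s0 I) w) //.
  by rewrite /word_step eqxx.
exists R; first by rewrite token1; apply: from_table_lt.
apply/andP; split.
  by apply/allP_b => j hj; rewrite hR // /f w2 nth_nil token1.
apply/allP_b => i hi; apply/allP_b => a; rewrite token1 => ha.
apply/implyP; rewrite enabledE // hs // => he.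
have hmem : nth [::] ws i \in ws.
  by case: (ltnP i (size ws)) => hi'; [| rewrite nth_default // -w2]; apply: mem_nth.
have /(nthP (s0 I))[i'] := w4 _ _ hmem ha he.
rewrite size_map => hi'; rewrite (nth_map [::]) // => e'.
have ki' : i' < k by exact: leq_trans hi' w1.
by apply/exP_b; exists i' => //; rewrite leads_toE // !hs // e'.
Qed.

Definition type_of (R a : nat) : nat := from_digits k.+1 k (fun i => next_state x k R i a).

Let target (t i : nat) := digit k.+1 t i.

Lemma next_state_le R i a : next_state x k R i a < k.+1.
Proof. by rewrite ltnS /next_state /countb -[X in _ <= X](size_iota 0) count_size. Qed.

Lemma type_of_lt R a : type_of R a < types k.
Proof. by apply: from_digits_lt => i _; apply: next_state_le. Qed.

Lemma target_type_of R a i : i < k -> target (type_of R a) i = next_state x k R i a.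
Proof. by move=> hi; apply: digit_from_digits => // j _; apply: next_state_le. Qed.

Lemma has_typeE R t a : t < types k -> has_type x k R t a = (type_of R a == t).
Proof.
move=> ht; apply/allP_b/eqP => [h|<- i hi]; last by rewrite -/(target _ _) target_type_of.
apply: (digit_inj (type_of_lt R a) ht) => i hi.
by rewrite -/(target _ _) target_type_of //; apply/esym/eqP; apply: h.
Qed.

Lemma next_stateE R i a : closed_family x k R -> i < k -> a < nA ->
  if aset I (act_of I a).1.1 \subset family_state R i then
    next_state x k R i a < k /\ family_state R (next_state x k R i a) = effect (family_state R i) a
  else next_state x k R i a = k.
Proof.
move=> /closed_familyE[_ h] hi ha; rewrite /next_state enabledE //.
case: ifP => hs; rewrite hs /=; last exact: etrans (count_predT _) (size_iota _ _).
rewrite countb_first; have [i' hi' e] := h i a hi ha hs.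
have hh : has (fun i' => leads_to x k R i a i') (iota 0 k).
  by apply/hasP; exists i'; rewrite ?mem_iota // leads_toE // e.
have hlt : find (fun i' => leads_to x k R i a i') (iota 0 k) < k.
  by rewrite -[X in _ < X](size_iota 0) -has_find.
split=> //; have := nth_find 0 hh; rewrite nth_iota // add0n leads_toE //.
by move=> /eqP.
Qed.

(** At each letter the type gives the index of the next state, or [k] where the precondition fails;
    so executability depends on the types alone. *)
Lemma exec_typed_run R i l : closed_family x k R -> i < k -> all (fun a => a < nA) l ->
  (exec_from (family_state R i) l != None) = typed_run k target i (map (type_of R) l).
Proof.
move=> hR; elim: l i => //= a l IH i hi /andP[ha hl].
rewrite exec_cons apply_actE target_type_of //; have := next_stateE hR hi ha.
by case: ifP => _ => [[hlt <-]|->]; rewrite ?ltnn // hlt IH.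
Qed.

Lemma action_executableE : action_executable I <->
  exists l r, [/\ perm_eq (tn_labels I) (l ++ r), exec_from (s0 I) l != None &
    forall a, count_mem a (goal_ms I) <= count_mem a l].
Proof.
set labels := tn_labels I; set lab := fun t : 'I_(size labels) => nth 0 labels t.
have labE : map lab (enum 'I_(size labels)) = labels.
  rewrite -[RHS](mkseq_nth 0) /mkseq -val_enum_ord -map_comp; exact: eq_map.
split.
  move=> [T' [prec [tbar [_ [_ [_ [_ [hu [_ [_ [he hc]]]]]]]]]]].
  exists (map lab tbar); have hsub : {subset tbar <= enum 'I_(size labels)}.
    by move=> t _; rewrite mem_enum.
  have /count_subseqP[s hs ps] : forall t, count_mem t tbar <= count_mem t (enum 'I_(size labels)).
    by move=> t; rewrite !count_uniq_mem ?enum_uniq // mem_enum; case: (t \in tbar).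
  have [r hr] := perm_to_subseq hs.
  exists (map lab r); split=> //.
  have h : perm_eq (enum 'I_(size labels)) (tbar ++ r).
    by rewrite (perm_trans hr) // perm_cat2r perm_sym.
  by have := perm_map lab h; rewrite labE map_cat.
move=> [l [r [hp he hc]]].
(* The rearrangement of labels is lifted to one of tasks, which are distinct even when their labels
   agree; the case without tasks is separate because a default task is needed. *)
have [ts pts ets] : exists2 ts, perm_eq (enum 'I_(size labels)) ts & map lab ts = l ++ r.
  have : perm_eq (l ++ r) (map lab (enum 'I_(size labels))) by rewrite labE perm_sym.
  case: (posnP (size labels)) => hn.
    move=> _; exists (enum 'I_(size labels)) => //.
    by rewrite labE; apply/esym/perm_small_eq; rewrite ?hn // perm_sym.
  pose t0 := Ordinal hn.
  move=> /(perm_iotaP (lab t0))[Is hIs ->].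
  rewrite size_map in hIs; exists (map (nth t0 (enum 'I_(size labels))) Is).
    by rewrite perm_sym; apply/(perm_iotaP t0); exists Is.
  rewrite -map_comp; apply/eq_in_map => i; rewrite (perm_mem hIs) mem_iota add0n => /= hi.
  by rewrite (nth_map t0).
have ul : uniq ts by rewrite -(perm_uniq pts) enum_uniq.
have el : map lab (take (size l) ts) = l by rewrite map_take ets take_size_cat.
exists [set t in take (size l) ts], (fun _ _ => false), (take (size l) ts).
rewrite no_order; do ![split=> //]; first exact: take_uniq.
- by move=> t; rewrite inE.
- by rewrite [map _ _]el.
- by move=> a; rewrite [map _ _]el.
Qed.

Lemma valid_flowP N :
  reflect (valid_flow k (types k) target (flow x k N))
    (flow_edges x k N && flow_balanced x k N && flow_connected x k N).
Proof.
set X := flow x k N.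
apply: (iffP idP) => [/andP[/andP[h1 h2] h3]|[h1 [e he h2] h3]].
  split.
  - by move=> i t hi ht; move/allP_b: h1 => /(_ i hi) /allP_b /(_ t ht) /implyP.
  - have /exP_b[e he /allP_b h] := h2; exists e => // v hv.
    have /eqP := h v hv; rewrite !sumbE => ->; congr (_ + _).
    by apply: eq_bigr => i _; rewrite sumbE.
  - move=> Z Z0 hZ i t hi ht hX.
    (* Only the values of [Z] below [k] matter, since arcs of positive multiplicity stay below [k];
       this makes an arbitrary predicate one of the [2 ^ k] codes. *)
    pose Zc := from_digits 2 k (fun i => Z i).
    have dZ j : j < k -> (digit 2 Zc j == 1) = Z j.
      by move=> hj; rewrite digit_from_digits // => [|m _]; case: (Z _).
    have hZc : Zc < 2 ^ k by apply: from_digits_lt => m _; case: (Z _).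
    have /allP_b/(_ _ hZc) := h3; rewrite dZ // Z0 /= => /implyP H.
    suff hcl : allb k (fun i => allb (types k) (fun t =>
        (0 < X i t) && (digit 2 Zc i == 1) ==> (digit 2 Zc (digit k.+1 t i) == 1))).
      by have /allP_b/(_ i hi)/allP_b/(_ t ht) := H hcl; rewrite dZ // -/X hX.
    apply/allP_b => j hj; apply/allP_b => u hu; apply/implyP => /andP[hXj]; rewrite dZ // => Zj.
    rewrite dZ; first exact: hZ.
    by move/allP_b: h1 => /(_ j hj) /allP_b /(_ u hu) /implyP; apply.
apply/andP; split; first (apply/andP; split).
- by apply/allP_b => i hi; apply/allP_b => t ht; apply/implyP; apply: h1.
- apply/exP_b; exists e => //; apply/allP_b => v hv; apply/eqP; rewrite !sumbE h2 //.
  by congr (_ + _); apply: eq_bigr => i _; rewrite sumbE.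
- apply/allP_b => Z _; apply/implyP => Z0; apply/implyP => hcl.
  apply/allP_b => i hi; apply/allP_b => t ht; apply/implyP => hX.
  apply: (h3 (fun i => digit 2 Z i == 1)) hX => // j u hj hu hXj Zj.
  by move/allP_b: hcl => /(_ j hj) /allP_b /(_ u hu) /implyP; apply; rewrite hXj.
Qed.

Lemma valid_flow_ext X Y : (forall i t, i < k -> t < types k -> X i t = Y i t) ->
  valid_flow k (types k) target X -> valid_flow k (types k) target Y.
Proof.
move=> e [h1 [v0 hv0 h2] h3]; split.
- by move=> i t hi ht; rewrite -e //; apply: h1.
- exists v0 => // v hv; have := h2 v hv.
  under eq_bigr do rewrite e //.
  move=> ->; congr (_ + _); apply: eq_bigr => i _; apply: eq_bigr => t _; by rewrite e.
- move=> Z Z0 hZ i t hi ht; rewrite -e //; apply: h3 => // j u hj hu hX.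
  by apply: hZ => //; rewrite -e.
Qed.

Lemma flow_boundsP R N :
  reflect (forall t, t < types k ->
      count (fun a => type_of R a == t) (goal_ms I) <= \sum_(i < k) flow x k N i t
        <= count (fun a => type_of R a == t) (tn_labels I))
    (flow_bounds x k R N).
Proof.
apply: (iffP (allP_b _ _)) => h t ht; have := h t ht;
  rewrite (countb_goalE no_order (has_type x k R t)) (countb_labelsE I (has_type x k R t)) sumbE;
  by rewrite !(eq_count (fun a => has_typeE R a ht)).
Qed.

(** Any closed family accepted by the search translates executions into runs of types. For the
    converse, the bound on reachable states provides such a family, and the flow of a solution is
    coded by [from_table]. *)
Lemma decider_correct : at_most_k_states I k -> decider x k <-> action_executable I.
Proof.
move=> hk; rewrite action_executableE.
have labA : all (fun a => a < nA) (tn_labels I) by [].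
(* [goal_available] inspects only the indices of actions; no other index occurs in a well-formed
   goal. *)
have goalA a : nA <= a -> count_mem a (goal_ms I) = 0.
  move=> ha; apply/eqP; rewrite -leqn0 leqNgt -has_count has_pred1.
  by move: wf => /andP[_ /allP h]; apply/negP => /h; lia.
have step1 R : closed_family x k R ->
    (exists l r, [/\ perm_eq (tn_labels I) (l ++ r), exec_from (s0 I) l != None &
       forall a, count_mem a (goal_ms I) <= count_mem a l]) <->
    (exists l r, [/\ perm_eq (tn_labels I) (l ++ r), typed_run k target 0 (map (type_of R) l) &
       forall a, count_mem a (goal_ms I) <= count_mem a l]).
  move=> hR; have [hR0 _] := closed_familyE hR.
  have E l r : perm_eq (tn_labels I) (l ++ r) ->
      (exec_from (s0 I) l != None) = typed_run k target 0 (map (type_of R) l).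
    move=> hp; rewrite -hR0; apply: exec_typed_run => //.
    by move: labA; rewrite (perm_all _ hp) all_cat => /andP[].
  by split=> -[l [r [h1 h2 h3]]]; exists l, r; split=> //; rewrite ?(E l r h1) // -(E l r h1).
rewrite /decider; split.
  move=> /andP[/allP_b hg /exP_b[R _ /andP[hR /exP_b[N _ /andP[/valid_flowP hv /flow_boundsP hb]]]]].
  rewrite (step1 R hR) (run_iff_flow target k_gt0 _ _ (type_of_lt R)).
  split.
    move=> a; case: (ltnP a nA) => ha; last by rewrite goalA.
    by have := hg a; rewrite token1 count_goalE // count_labelsE; apply.
  exists (flow x k N); split=> // i t.
  by rewrite -token_labelsE -ltnS; apply: digit_lt.
move=> hx; have [R hR1 hR2] := exists_closed_family hk.
move: hx; rewrite (step1 R hR2) (run_iff_flow target k_gt0 _ _ (type_of_lt R)).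
move=> [hg [X [x1 x2 x3]]]; apply/andP; split.
  by apply/allP_b => a _; rewrite count_goalE // count_labelsE.
apply/exP_b; exists R => //; rewrite hR2 /=.
have hX i t : X i t < (token x (pos_labels x)).+1 by rewrite ltnS token_labelsE.
pose N := from_table (token x (pos_labels x)).+1 k (types k) X.
have hN i t : i < k -> t < types k -> X i t = flow x k N i t.
  by move=> hi ht; rewrite /flow digit_from_table.
apply/exP_b; exists N; first exact: from_table_lt.
apply/andP; split; first by apply/valid_flowP; apply: valid_flow_ext x1.
apply/flow_boundsP => t ht.
have <- : \sum_(i < k) X i t = \sum_(i < k) flow x k N i t by apply: eq_bigr => i _; apply: hN.
exact: x3.
Qed.

End Correctness.

Theorem theorem4 :
  forall k : nat, exists (M : TM) (c d : nat),
    forall I : instance,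
      wf_instance I -> primitive_tn I -> tn_order I = [::] ->
      at_most_k_states I k ->
      decides_within M (encode I) (action_executable I) (c * size (encode I) ^ d + c).
Proof.
move=> k; have [e he] := def_decider k.
have [M [c [d hM]]] := expr_decidable e.
exists M, c, d => I wf prim no_order hk.
(* The initial state is reachable by the empty sequence, so it is one of the at most [k] states. *)
have k_gt0 : 0 < k.
  by apply: (hk [:: s0 I]) => // s; rewrite mem_seq1 => /eqP ->; exists [::].
have [n [hn [hh ha]]] := hM (encode I).
exists n; split=> //; split=> //; rewrite ha he.
rewrite -(decider_correct k_gt0 wf prim no_order hk).
by case: (decider _ _).
Qed.
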